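(* Let $B\subset\mathbb{R}^3$ be a $3$-smooth convex body with projection curvature radius function $R(\omega,\varphi)$, and let $H(\Omega)$, $\Omega\in\mathbf{S}^2$, be the support function of $B$ with respect to its centroid $O^*$. Then for every $\Omega\in\mathbf{S}^2$ $$H(\Omega)=\frac1{4\pi}\int_0^{2\pi}\left[\int_0^{\frac{\pi}{2}}R((0,\tau)_\Omega,\varphi)\cos\varphi\,d\varphi\right]d\tau+\frac1{8\pi^2}\int_0^{2\pi}\left[\int_{-\frac{\pi}{2}}^{\frac{\pi}{2}}R((0,\tau)_\Omega,\varphi)\bigl((\pi+2\varphi)\cos\varphi-2\sin^3\varphi\bigr)\,d\varphi\right]d\tau$$ $$-\frac1{2\pi^2}\int_0^{\frac{\pi}{2}}\frac{\sin\nu}{\cos^2\nu}\left(\int_0^{2\pi}\left(\int_0^{2\pi}R((\nu,\tau)_\Omega,\varphi)\sin^3\varphi\,d\varphi\right)d\tau\right)d\nu,$$ where on each circle $\mathbf{S}_\omega$ the angle $\varphi$ is measured from the East direction with respect to $\Omega$, and the last integral is an iterated integral in the indicated order. The function given by the right-hand side is a spherical solution of the equation $$H_\omega(\varphi)+[H_\omega(\varphi)]''_{\varphi\varphi}=R(\omega,\varphi)\quad\text{for every }\omega\in\mathbf{S}^2\text{ and }\varphi\in\mathbf{S}_\omega .$$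
   Context: $\mathbf{S}^2$ is the unit sphere in $\mathbb{R}^3$; $\mathbf{S}_\omega\subset\mathbf{S}^2$ is the great circle with pole $\omega$ (unit vectors orthogonal to $\omega$). Support function: for a point $Q\in\mathbb{R}^3$, the support function of $B$ with respect to $Q$ is $H_Q(\Omega)=\max\{\langle\Omega,y-Q\rangle:y\in B\}$, $\Omega\in\mathbf{S}^2$. $B$ is $k$-smooth if its support function belongs to $C^k(\mathbf{S}^2)$. Projection curvature radius function: $B(\omega)$ is the orthogonal projection of $B$ onto the plane through the origin orthogonal to $\omega$, and $R(\omega,\varphi)$ is the curvature radius of $\partial B(\omega)$ at the point whose outer normal direction is $\varphi\in\mathbf{S}_\omega$. Coordinates: given $\Omega\in\mathbf{S}^2$ taken as North Pole and a reference point $\tau=0$ on the equator $\mathbf{S}_\Omega$, $(\nu,\tau)_\Omega$ denotes the point of $\mathbf{S}^2$ with latitude $\nu=\frac{\pi}{2}-\widehat{(\omega,\Omega)}$ and longitude $\tau$, so that the points $(0,\tau)_\Omega$ lie on $\mathbf{S}_\Omega$. For $\omega=(\nu,\tau)_\Omega$, directions in $\mathbf{S}_\omega$ are given by an angle $\varphi$ with reference point $\varphi=0$ the direction East at $\omega$ (tangent, direction of increasing $\tau$) and the anticlockwise direction positive, so that $\varphi=\frac{\pi}{2}$ is the direction North at $\omega$ (tangent, direction of increasing $\nu$). Centroid: the centroid of $B$ is the point $O^*\in\mathbb{R}^3$ such that $\int_0^{2\pi}\frac{\partial}{\partial\nu}\bigl[H_{O^*}((\nu,\tau)_\Omega)\bigr]_{\nu=0}\,d\tau=0$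 for every $\Omega\in\mathbf{S}^2$. Spherical solution: for a function $H$ on $\mathbf{S}^2$, $H_\omega$ is its restriction to $\mathbf{S}_\omega$ and $[H_\omega(\varphi)]''_{\varphi\varphi}$ the second derivative with respect to the angle along $\mathbf{S}_\omega$; a spherical solution of the displayed equation is a function $H\in C^2(\mathbf{S}^2)$ whose restrictions satisfy it. *)

(* Defs.v *)
From Stdlib Require Import Reals List Lra Classical.
From Coquelicot Require Import Coquelicot.

Local Open Scope R_scope.

Definition R3 : NormedModule R_AbsRing :=
  prod_NormedModule R_AbsRing
    (prod_NormedModule R_AbsRing R_NormedModule R_NormedModule) R_NormedModule.

Definition vec3 (x y z : R) : R3 := (x, y, z).

Definition dot (u v : R3) : R :=
  fst (fst u) * fst (fst v) + snd (fst u) * snd (fst v) + snd u * snd v.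

Definition cross (u v : R3) : R3 :=
  vec3 (snd (fst u) * snd v - snd u * snd (fst v))
       (snd u * fst (fst v) - fst (fst u) * snd v)
       (fst (fst u) * snd (fst v) - snd (fst u) * fst (fst v)).

Definition length3 (v : R3) : R := sqrt (dot v v).

Definition S2 (u : R3) : Prop := dot u u = 1.

Definition great_circle (omega u : R3) : Prop := S2 u /\ dot omega u = 0.

(* For u in great_circle omega: the point of that circle at angle phi from u,
   anticlockwise when seen from the tip of omega. *)
Definition circle_point (omega u : R3) (phi : R) : R3 :=
  plus (scal (cos phi) u) (scal (sin phi) (cross omega u)).

Definition basis3 : list R3 := vec3 1 0 0 :: vec3 0 1 0 :: vec3 0 0 1 :: nil.

(* All partial derivatives of F up to order k exist on the open set U, and those
   of order k are continuous there.  The lower-order ones are then continuous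
   as well. *)
Fixpoint Ck_on (k : nat) (U : R3 -> Prop) (F : R3 -> R) : Prop :=
  match k with
  | O => forall x, U x -> continuous F x
  | S k' => forall e, In e basis3 ->
      (forall x, U x -> ex_derive (fun t : R => F (plus x (scal t e))) 0) /\
      Ck_on k' U (fun x => Derive (fun t : R => F (plus x (scal t e))) 0)
  end.

(* C^k on the submanifold S2: near each of its points, f is the restriction of
   a C^k function of the ambient space. *)
Definition Ck_S2 (k : nat) (f : R3 -> R) : Prop :=
  forall p, S2 p -> exists (U : R3 -> Prop) (F : R3 -> R),
    open U /\ U p /\ Ck_on k U F /\ (forall x, U x -> S2 x -> F x = f x).

Definition compact_set (B : R3 -> Prop) : Prop :=
  forall (I : Type) (U : I -> R3 -> Prop),
    (forall i, open (U i)) -> (forall x, B x -> exists i, U i x) ->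
    exists l : list I, forall x, B x -> exists i, In i l /\ U i x.

Definition convex_body (B : R3 -> Prop) : Prop :=
  compact_set B /\
  (forall x y t, B x -> B y -> 0 <= t <= 1 ->
     B (plus (scal (1 - t) x) (scal t y))) /\
  (exists x, locally x B).

(* The least upper bound is a maximum when B is a convex body: see support_max. *)
Definition support (B : R3 -> Prop) (Q u : R3) : R :=
  Lub_Rbar (fun z => exists y, B y /\ z = dot u (minus y Q)).

(* Changing the reference point from the origin to Q subtracts the linear
   function dot u Q, so the choice does not matter here. *)
Definition smooth_body (k : nat) (B : R3 -> Prop) : Prop :=
  Ck_S2 k (support B zero).

Definition projection (B : R3 -> Prop) (omega x : R3) : Prop :=
  exists y, B y /\ x = minus y (scal (dot omega y) omega).

Definition outer_normal (K : R3 -> Prop) (x u : R3) : Prop :=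
  K x /\ forall y, K y -> dot u y <= dot u x.

(* K is a convex set in the plane orthogonal to omega and u a direction of that
   plane.  The boundary curve p is parametrized by the angle phi of its outer
   normal, with phi = 0 at u, and the radius of curvature is ds/dphi, s being
   arc length; it may vanish, since the boundary itself need not be regular. *)
Definition is_curvature_radius (K : R3 -> Prop) (omega u : R3) (r : R) : Prop :=
  exists (p : R -> R3) (v : R3),
    (forall phi, outer_normal K (p phi) (circle_point omega u phi)) /\
    is_derive p 0 v /\ r = length3 v.

(* Rad omega u stands for R(omega, phi), the direction u replacing its angle. *)
Definition is_proj_curvature_radius (B : R3 -> Prop) (Rad : R3 -> R3 -> R) : Prop :=
  forall omega u, S2 omega -> great_circle omega u ->
    is_curvature_radius (projection B omega) omega u (Rad omega u).

(* a Omega is the point tau = 0 of the equator of pole Omega. *)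
Definition reference_points (a : R3 -> R3) : Prop :=
  forall Omega, S2 Omega -> great_circle Omega (a Omega).

(* (nu, tau)_Omega *)
Definition sph (a : R3 -> R3) (Omega : R3) (nu tau : R) : R3 :=
  plus (scal (cos nu) (circle_point Omega (a Omega) tau)) (scal (sin nu) Omega).

(* East is d/dtau of the point of longitude tau of the equator; it is also the
   unit direction of increasing tau at (nu, tau)_Omega. *)
Definition east (a : R3 -> R3) (Omega : R3) (tau : R) : R3 :=
  circle_point Omega (a Omega) (tau + PI / 2).

Definition radius_at (Rad : R3 -> R3 -> R) (a : R3 -> R3)
    (Omega : R3) (nu tau phi : R) : R :=
  let omega := sph a Omega nu tau in
  Rad omega (circle_point omega (east a Omega tau) phi).

Definition is_centroid (a : R3 -> R3) (B : R3 -> Prop) (O : R3) : Prop :=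
  forall Omega, S2 Omega ->
    RInt (fun tau => Derive (fun nu => support B O (sph a Omega nu tau)) 0)
         0 (2 * PI) = 0.

Definition third_integrand (Rad : R3 -> R3 -> R) (a : R3 -> R3)
    (Omega : R3) (nu : R) : R :=
  sin nu / cos nu ^ 2 *
  RInt (fun tau =>
    RInt (fun phi => radius_at Rad a Omega nu tau phi * sin phi ^ 3)
         0 (2 * PI)) 0 (2 * PI).

(* Only the last integrand is singular, at nu = PI/2. *)
Definition representation (Rad : R3 -> R3 -> R) (a : R3 -> R3) (Omega : R3) : R :=
  1 / (4 * PI) *
    RInt (fun tau =>
      RInt (fun phi => radius_at Rad a Omega 0 tau phi * cos phi)
           0 (PI / 2)) 0 (2 * PI)
  + 1 / (8 * PI ^ 2) *
    RInt (fun tau =>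
      RInt (fun phi => radius_at Rad a Omega 0 tau phi *
                       ((PI + 2 * phi) * cos phi - 2 * sin phi ^ 3))
           (- (PI / 2)) (PI / 2)) 0 (2 * PI)
  - 1 / (2 * PI ^ 2) *
    RInt_gen (third_integrand Rad a Omega) (at_point 0) (at_left (PI / 2)).

Definition spherical_solution (Rad : R3 -> R3 -> R) (H : R3 -> R) : Prop :=
  Ck_S2 2 H /\
  forall omega u, S2 omega -> great_circle omega u -> forall phi,
    let H_omega := fun t => H (circle_point omega u t) in
    H_omega phi + Derive_n H_omega 2 phi = Rad omega (circle_point omega u phi).

Lemma continuous_dot (u x : R3) : continuous (dot u) x.
Proof.
unfold dot.
apply (continuous_plus (V := R_NormedModule)
         (fun y : R3 => fst (fst u) * fst (fst y) + snd (fst u) * snd (fst y))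
         (fun y : R3 => snd u * snd y)).
- apply (continuous_plus (V := R_NormedModule)
           (fun y : R3 => fst (fst u) * fst (fst y))
           (fun y : R3 => snd (fst u) * snd (fst y))).
  + apply (continuous_scal_r (V := R_NormedModule)
             (fst (fst u)) (fun y : R3 => fst (fst y))).
    apply continuous_comp; apply continuous_fst.
  + apply (continuous_scal_r (V := R_NormedModule)
             (snd (fst u)) (fun y : R3 => snd (fst y))).
    apply continuous_comp; [apply continuous_fst | apply continuous_snd].
- apply (continuous_scal_r (V := R_NormedModule) (snd u) (fun y : R3 => snd y)).
  apply continuous_snd.
Qed.

Lemma dot_minus (u y Q : R3) : dot u (minus y Q) = dot u y - dot u Q.
Proof.
destruct u as [[? ?] ?], y as [[? ?] ?], Q as [[? ?] ?].
unfold dot, minus, plus, opp; simpl; unfold plus, opp; simpl; ring.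
Qed.

Lemma compact_dot_max (B : R3 -> Prop) (u : R3) :
  compact_set B -> (exists x, B x) ->
  exists y, B y /\ forall z, B z -> dot u z <= dot u y.
Proof.
intros cB [x0 Bx0].
apply NNPP; intros nomax.
destruct (cB R3 (fun y x => B y /\ dot u x < dot u y)) as [l Hl].
- intros y x [By Hx].
  assert (L : locally x (fun x' => dot u x' < dot u y)).
  { apply (continuous_dot u x (fun t => t < dot u y)).
    now apply (open_lt (dot u y)). }
  revert L; apply filter_imp; auto.
- intros x Bx.
  apply NNPP; intros Hx; apply nomax.
  exists x; split; [exact Bx|].
  intros z Bz; destruct (Rle_dec (dot u z) (dot u x)) as [h|h]; [exact h|].
  exfalso; apply Hx; exists z; split; [exact Bz|lra].
- assert (M : forall l : list R3, (exists i, In i l /\ B i) ->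
     exists i, In i l /\ B i /\ forall j, In j l -> B j -> dot u j <= dot u i).
  { clear; induction l as [|y l IH]; intros [i [Hi Bi]]; [destruct Hi|].
    destruct (classic (exists i, In i l /\ B i)) as [h|h].
    - destruct (IH h) as [m [Hm [Bm Mm]]].
      destruct (classic (B y /\ dot u m < dot u y)) as [[By hy]|hy].
      + exists y; repeat split; [now left | exact By |].
        intros j [<-|Hj] Bj; [lra|]; specialize (Mm j Hj Bj); lra.
      + exists m; repeat split; [now right | exact Bm |].
        intros j [<-|Hj] Bj; [|now apply Mm].
        apply Rnot_lt_le; intros c; now apply hy.
    - destruct Hi as [<-|Hi]; [|exfalso; apply h; now exists i].
      exists y; repeat split; [now left | exact Bi |].
      intros j [<-|Hj] Bj; [lra|]; exfalso; apply h; now exists j. }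
  destruct (M l) as [m [Hm [Bm Mm]]].
  { destruct (Hl x0 Bx0) as [i [Hi [Bi _]]]; now exists i. }
  destruct (Hl m Bm) as [i [Hi [Bi hi]]].
  specialize (Mm i Hi Bi); lra.
Qed.

Lemma support_max (B : R3 -> Prop) (Q u : R3) : convex_body B ->
  (exists y, B y /\ support B Q u = dot u (minus y Q)) /\
  (forall y, B y -> dot u (minus y Q) <= support B Q u).
Proof.
intros [cB [_ [x Bx]]].
destruct (compact_dot_max B u cB) as [y [By My]].
{ exists x; exact (locally_singleton x B Bx). }
assert (E : support B Q u = dot u (minus y Q)).
{ unfold support.
  rewrite (is_lub_Rbar_unique _ (Finite (dot u (minus y Q)))); [reflexivity|].
  split.
  - intros z [y' [By' ->]]; simpl.
    rewrite !dot_minus; specialize (My y' By'); lra.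
  - intros b Hb; apply Hb; now exists y. }
split; [now exists y|].
intros y' By'; rewrite E, !dot_minus; specialize (My y' By'); lra.
Qed.

(* Main.v *)
Require Import Defs.
From Stdlib Require Import Reals.
From Coquelicot Require Import Coquelicot.
From Stdlib Require Import List Lra ClassicalEpsilon.
Local Open Scope R_scope.

(* Let H be the support function with respect to the centroid.  On each great circle the
   boundary point with outer normal n is H n + H' n', so R = H + H''.  After this
   substitution, two integrations by parts in phi leave only H in the three integrals.
   By the centroid condition the first term becomes H(Omega)/2, and the second one
   H(Omega)/2 - 2 J / pi^2, where J is the integral over phi in (-pi/2, pi/2) and tau of
   H((phi, tau)_Omega) sin(phi) cos(phi)^2.  It remains to see that the third term is
   2 J / pi^2.  Let A(nu, phi) be the integral over tau of H at the point of angle phi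
   of the circle with pole (nu, tau)_Omega.  Since A is an average over rotations about
   Omega,
     cos(nu) cos(phi) dA/dnu + sin(nu) sin(phi) dA/dphi = 0,
   and therefore (2 / cos(nu)) times the integral of A(nu, phi) sin(phi) cos(phi)^2 over
   phi in (0, 2 pi) is a primitive of the third integrand.  Its value at nu = 0 is 4 J,
   and it tends to 0 at pi/2, because there A(nu, .) is constant and dA/dnu vanishes by
   the centroid condition. *)

(** The support function is smooth on the sphere only through local extensions F, which change from
    point to point, so it has no gradient of its own. The product p x grad F(p) is independent of
    the extension. It gives a single formula for the derivative along every curve of the sphere,
    jointly continuous in all angles, as differentiation under the integral and exchange of
    integrals require.

    Nothing is assumed about the regularity of [Rad], and second derivatives are only met along one
    circle at a time. The integrations by parts in phi remove them before anything is integrated in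
    tau or nu.

    The weights K are explained by K + K'': it is 0 for cos, so that only boundary values survive;
    sin^3 and its derivative vanish at 0 and 2 pi, so that no boundary value survives; in the second
    weight the shift pi in pi + 2 phi makes K' vanish at - pi/2, which eliminates H(-Omega). *)

Ltac vec_unfold :=
  repeat progress (unfold circle_point, cross, dot, vec3, minus, plus, opp, scal, zero, mult,
    prod_plus, prod_opp, prod_scal, prod_zero; simpl).

Ltac R_ring :=
  repeat match goal with
    | v : NormedModule.sort _ _ |- _ => change R in v
    | v : AbsRing.sort _ |- _ => change R in v
    end;
  match goal with |- @eq _ ?x ?y => change (@eq R x y) end; ring.

Ltac vec := vec_unfold; first [R_ring | apply f_equal2; [apply f_equal2|]; R_ring].

(** * Differential calculus in [R3] *)

Definition partial (e : R3) (F : R3 -> R) (x : R3) : R :=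
  Derive (fun t : R => F (plus x (scal t e))) 0.

Definition gradient (F : R3 -> R) (x : R3) : R3 :=
  vec3 (partial (vec3 1 0 0) F x) (partial (vec3 0 1 0) F x) (partial (vec3 0 0 1) F x).

Lemma vec3_eta (u : R3) : u = vec3 (fst (fst u)) (snd (fst u)) (snd u).
Proof. now destruct u as [[x y] z]. Qed.

Lemma coord_le_norm (x y z : R) :
  Rabs x <= norm (vec3 x y z) /\ Rabs y <= norm (vec3 x y z) /\
  Rabs z <= norm (vec3 x y z).
Proof.
assert (H12 := norm_le_prod_norm_1 (vec3 x y z : prod_NormedModule _ _ _)).
repeat split.
- apply Rle_trans with (2 := H12).
  exact (norm_le_prod_norm_1 (U := R_NormedModule) (V := R_NormedModule) (x, y)).
- apply Rle_trans with (2 := H12).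
  exact (norm_le_prod_norm_2 (U := R_NormedModule) (V := R_NormedModule) (x, y)).
- exact (norm_le_prod_norm_2 (vec3 x y z : prod_NormedModule _ _ _)).
Qed.

Lemma is_linear_dot (w : R3) : is_linear (V := R_NormedModule) (dot w).
Proof.
destruct w as [[a b] c].
split.
- intros [[x y] z] [[x' y'] z']; vec_unfold; ring.
- intros k [[x y] z]; vec_unfold; ring.
(* The added 1 keeps the constant positive for the zero vector, as [is_linear] demands. *)
- exists (Rabs a + Rabs b + Rabs c + 1); split.
  { generalize (Rabs_pos a) (Rabs_pos b) (Rabs_pos c); lra. }
  intros [[x y] z]; destruct (coord_le_norm x y z) as [h1 [h2 h3]].
  set (N := norm (vec3 x y z)) in *.
  assert (0 <= N) by apply norm_ge_0.
  change (Rabs (a * x + b * y + c * z) <= (Rabs a + Rabs b + Rabs c + 1) * N).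
  eapply Rle_trans; [apply Rabs_triang|].
  eapply Rle_trans; [apply Rplus_le_compat_r, Rabs_triang|].
  rewrite !Rabs_mult.
  generalize (Rmult_le_compat_l _ _ _ (Rabs_pos a) h1)
    (Rmult_le_compat_l _ _ _ (Rabs_pos b) h2)
    (Rmult_le_compat_l _ _ _ (Rabs_pos c) h3); lra.
Qed.

(** Balls of the product structure are cubes, so a path that changes one coordinate at a time
    between two points of such a ball never leaves it. *)
Lemma ball_vec3 (x y z x' y' z' : R) (d : R) :
  ball (vec3 x y z) d (vec3 x' y' z') <->
  Rabs (x' - x) < d /\ Rabs (y' - y) < d /\ Rabs (z' - z) < d.
Proof. split; [intros [[h1 h2] h3]|intros [h1 [h2 h3]]]; repeat split; assumption. Qed.

Lemma is_derive_axis (e : R3) (F : R3 -> R) (x : R3) (s : R) :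
  ex_derive (fun t : R => F (plus (plus x (scal s e)) (scal t e))) 0 ->
  is_derive (fun r : R => F (plus x (scal r e))) s (partial e F (plus x (scal s e))).
Proof.
intros H.
apply (is_derive_ext (fun r : R => F (plus (plus x (scal s e)) (scal (r - s) e)))).
{ intros r; f_equal.
  destruct x as [[? ?] ?], e as [[? ?] ?]; vec. }
rewrite <- (Rmult_1_l (partial _ _ _)).
apply (is_derive_comp (fun t : R => F (plus (plus x (scal s e)) (scal t e)))
         (fun r => r - s)).
- replace (s - s) with 0 by ring. now apply Derive_correct.
- auto_derive; auto; ring.
Qed.

(** Mean value theorem along the axis: the increment is h times a partial derivative at an
    intermediate point, within [eps] of g. *)
Lemma axis_increment (e : R3) (F : R3 -> R) (x : R3) (h g eps : R) :
  (forall s, Rmin 0 h <= s <= Rmax 0 h ->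
     ex_derive (fun t : R => F (plus (plus x (scal s e)) (scal t e))) 0 /\
     Rabs (partial e F (plus x (scal s e)) - g) <= eps) ->
  Rabs (F (plus x (scal h e)) - F x - h * g) <= eps * Rabs h.
Proof.
intros H.
destruct (MVT_gen (fun r : R => F (plus x (scal r e))) 0 h
            (fun s => partial e F (plus x (scal s e)))) as [c [Hc E]].
- intros s Hs; apply is_derive_axis, H; lra.
- intros s Hs; apply continuity_pt_filterlim.
  apply (ex_derive_continuous (fun r : R => F (plus x (scal r e)))).
  eexists; apply is_derive_axis, H; lra.
- replace (plus x (scal 0 e)) with x in E by (destruct x as [[? ?] ?], e as [[? ?] ?]; vec).
  rewrite E, Rminus_0_r.
  replace (_ - _) with ((partial e F (plus x (scal c e)) - g) * h) by ring.
  rewrite Rabs_mult; apply Rmult_le_compat_r; [apply Rabs_pos|].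
  now apply H.
Qed.

(** Continuous partial derivatives give differentiability: the increment is cut into three, one for
    each axis, and [axis_increment] compares each with the partial derivative at x. *)
Lemma filterdiff_gradient (F : R3 -> R) (U : R3 -> Prop) (x : R3) :
  open U -> U x ->
  (forall e, In e basis3 ->
     (forall y, U y -> ex_derive (fun t : R => F (plus y (scal t e))) 0) /\
     continuous (partial e F) x) ->
  filterdiff (V := R_NormedModule) F (locally x) (dot (gradient F x)).
Proof.
intros oU Ux H.
split; [apply is_linear_dot|].
intros x' Hx'.
apply is_filter_lim_locally_unique in Hx'; subst x'.
intros eps.
assert (He : 0 < eps / 3) by (generalize (cond_pos eps); lra).
assert (L : forall e, In e basis3 -> locally x (fun y =>
   ex_derive (fun t : R => F (plus y (scal t e))) 0 /\
   Rabs (partial e F y - partial e F x) <= eps / 3)).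
{ intros e Ie; destruct (H e Ie) as [H1 H2].
  apply filter_and.
  - generalize (oU x Ux); apply filter_imp; auto.
  - apply (filterlim_locally (partial e F) (partial e F x)) with (eps := mkposreal _ He) in H2.
    revert H2; apply filter_imp; intros y Hy; apply Rlt_le, Hy. }
destruct (L (vec3 1 0 0)) as [d1 D1]; [now left|].
destruct (L (vec3 0 1 0)) as [d2 D2]; [now right; left|].
destruct (L (vec3 0 0 1)) as [d3 D3]; [now right; right; left|].
assert (Hd : 0 < Rmin d1 (Rmin d2 d3)).
{ repeat apply Rmin_glb_lt; apply cond_pos. }
exists (mkposreal _ Hd).
intros y By.
assert (B1 := ball_le x _ _ (Rmin_l d1 (Rmin d2 d3)) _ By).
assert (B2 := ball_le x _ _ (Rle_trans _ _ _ (Rmin_r d1 (Rmin d2 d3)) (Rmin_l d2 d3)) _ By).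
assert (B3 := ball_le x _ _ (Rle_trans _ _ _ (Rmin_r d1 (Rmin d2 d3)) (Rmin_r d2 d3)) _ By).
clear By.
rewrite (vec3_eta x), (vec3_eta y) in *.
destruct x as [[x1 x2] x3], y as [[y1 y2] y3]; simpl fst in *; simpl snd in *.
apply ball_vec3 in B1; apply ball_vec3 in B2; apply ball_vec3 in B3.
assert (btw : forall a b s d, Rmin 0 (b - a) <= s <= Rmax 0 (b - a) -> Rabs (b - a) < d ->
          Rabs (a + s - a) < d).
{ intros a b s d Hs Hd'.
  apply Rle_lt_trans with (2 := Hd').
  unfold Rmin, Rmax in Hs; destruct (Rle_dec 0 (b - a)).
  - rewrite !Rabs_pos_eq; lra.
  - rewrite !Rabs_left1; lra. }
assert (ctr : forall a (d : posreal), Rabs (a - a) < d).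
{ intros a d; rewrite Rminus_diag, Rabs_R0; apply cond_pos. }
(* The path from y back to x replaces the coordinates one after the other, in the order first,
   second, third. Each piece may cost [eps / 3]. *)
assert (I1 : Rabs (F (vec3 y1 y2 y3) - F (vec3 x1 y2 y3)
                   - (y1 - x1) * partial (vec3 1 0 0) F (vec3 x1 x2 x3))
             <= eps / 3 * Rabs (y1 - x1)).
{ replace (vec3 y1 y2 y3) with (plus (vec3 x1 y2 y3) (scal (y1 - x1) (vec3 1 0 0)) : R3)
    by (vec).
  apply axis_increment; intros s Hs.
  apply (D1 (plus (vec3 x1 y2 y3) (scal s (vec3 1 0 0)) : R3)).
  replace (plus _ _) with (vec3 (x1 + s) y2 y3) by (vec).
  apply ball_vec3; repeat split; try apply (btw _ _ _ _ Hs); apply B1. }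
assert (I2 : Rabs (F (vec3 x1 y2 y3) - F (vec3 x1 x2 y3)
                   - (y2 - x2) * partial (vec3 0 1 0) F (vec3 x1 x2 x3))
             <= eps / 3 * Rabs (y2 - x2)).
{ replace (vec3 x1 y2 y3) with (plus (vec3 x1 x2 y3) (scal (y2 - x2) (vec3 0 1 0)) : R3)
    by (vec).
  apply axis_increment; intros s Hs.
  apply (D2 (plus (vec3 x1 x2 y3) (scal s (vec3 0 1 0)) : R3)).
  replace (plus _ _) with (vec3 x1 (x2 + s) y3) by (vec).
  apply ball_vec3; repeat split; try apply (btw _ _ _ _ Hs); try apply ctr; apply B2. }
assert (I3 : Rabs (F (vec3 x1 x2 y3) - F (vec3 x1 x2 x3)
                   - (y3 - x3) * partial (vec3 0 0 1) F (vec3 x1 x2 x3))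
             <= eps / 3 * Rabs (y3 - x3)).
{ replace (vec3 x1 x2 y3) with (plus (vec3 x1 x2 x3) (scal (y3 - x3) (vec3 0 0 1)) : R3)
    by (vec).
  apply axis_increment; intros s Hs.
  apply (D3 (plus (vec3 x1 x2 x3) (scal s (vec3 0 0 1)) : R3)).
  replace (plus _ _) with (vec3 x1 x2 (x3 + s)) by (vec).
  apply ball_vec3; repeat split; try apply (btw _ _ _ _ Hs); try apply ctr; apply B3. }
destruct (coord_le_norm (y1 - x1) (y2 - x2) (y3 - x3)) as [n1 [n2 n3]].
change (norm (minus (vec3 y1 y2 y3) (vec3 x1 x2 x3))) with (norm (vec3 (y1 - x1) (y2 - x2) (y3 - x3))).
set (N := norm (vec3 (y1 - x1) (y2 - x2) (y3 - x3))) in *.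
match goal with |- norm ?A <= _ => change (norm A) with (Rabs A) end.
match goal with |- Rabs ?A <= _ => replace A with
  ((F (vec3 y1 y2 y3) - F (vec3 x1 y2 y3)
                   - (y1 - x1) * partial (vec3 1 0 0) F (vec3 x1 x2 x3)) +
   (F (vec3 x1 y2 y3) - F (vec3 x1 x2 y3)
                   - (y2 - x2) * partial (vec3 0 1 0) F (vec3 x1 x2 x3)) +
   (F (vec3 x1 x2 y3) - F (vec3 x1 x2 x3)
                   - (y3 - x3) * partial (vec3 0 0 1) F (vec3 x1 x2 x3))) end.
2:{ unfold dot, gradient, minus, plus, opp; simpl; unfold plus, opp; simpl. ring. }
eapply Rle_trans; [apply Rabs_triang|].
eapply Rle_trans; [apply Rplus_le_compat_r, Rabs_triang|].
generalize (Rmult_le_compat_l _ _ _ (Rlt_le _ _ He) n1)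
  (Rmult_le_compat_l _ _ _ (Rlt_le _ _ He) n2)
  (Rmult_le_compat_l _ _ _ (Rlt_le _ _ He) n3); lra.
Qed.

Lemma is_derive_Rplus (f g : R -> R) (x a b : R) :
  is_derive f x a -> is_derive g x b -> is_derive (fun s => f s + g s) x (a + b).
Proof. exact (is_derive_plus (V := R_NormedModule) f g x a b). Qed.

Lemma is_derive_Rmult (f g : R -> R) (x a b : R) :
  is_derive f x a -> is_derive g x b -> is_derive (fun s => f s * g s) x (a * g x + f x * b).
Proof. intros Ha Hb; exact (is_derive_mult f g x a b Ha Hb Rmult_comm). Qed.

Lemma continuous_Rplus (T : UniformSpace) (f g : T -> R) (x : T) :
  continuous f x -> continuous g x -> continuous (fun s => f s + g s) x.
Proof. exact (continuous_plus (V := R_NormedModule) f g x). Qed.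

Lemma continuous_Rminus (T : UniformSpace) (f g : T -> R) (x : T) :
  continuous f x -> continuous g x -> continuous (fun s => f s - g s) x.
Proof. exact (continuous_minus (V := R_NormedModule) f g x). Qed.

Lemma continuous_Rmult (T : UniformSpace) (f g : T -> R) (x : T) :
  continuous f x -> continuous g x -> continuous (fun s => f s * g s) x.
Proof. exact (continuous_mult f g x). Qed.

Lemma is_derive_comp_R3 (F : R3 -> R) (G : R3) (c : R -> R3) (t : R) (v : R3) :
  filterdiff (V := R_NormedModule) F (locally (c t)) (dot G) ->
  is_derive c t v -> is_derive (fun s => F (c s)) t (dot G v).
Proof.
intros HF Hc.
apply (filterdiff_ext_lin (V := R_NormedModule) _ (fun h : R => dot G (scal h v))).
- exact (filterdiff_comp' (W := R_NormedModule) c F t _ _ Hc HF).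
- intros h; destruct G as [[? ?] ?], v as [[? ?] ?]; vec.
Qed.

Lemma is_derive_vec3 (x y z : R -> R) (t x' y' z' : R) :
  is_derive x t x' -> is_derive y t y' -> is_derive z t z' ->
  is_derive (V := R3) (fun s => vec3 (x s) (y s) (z s)) t (vec3 x' y' z').
Proof.
intros Hx Hy Hz.
apply (is_derive_ext (V := R3) (fun s => plus (plus (scal (x s) (vec3 1 0 0)) (scal (y s) (vec3 0 1 0)))
                                 (scal (z s) (vec3 0 0 1)))).
{ intros s; vec. }
replace (vec3 x' y' z') with
  (plus (plus (scal x' (vec3 1 0 0)) (scal y' (vec3 0 1 0))) (scal z' (vec3 0 0 1)) : R3) by vec.
apply (is_derive_plus (V := R3)); [apply (is_derive_plus (V := R3))|].
- now apply (is_derive_scal_l (V := R3) x t x' (vec3 1 0 0)).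
- now apply (is_derive_scal_l (V := R3) y t y' (vec3 0 1 0)).
- now apply (is_derive_scal_l (V := R3) z t z' (vec3 0 0 1)).
Qed.

Lemma is_derive_dot (c d : R -> R3) (t : R) (v w : R3) :
  is_derive c t v -> is_derive d t w ->
  is_derive (fun s => dot (c s) (d s)) t (dot v (d t) + dot (c t) w).
Proof.
intros Hc Hd.
assert (L : forall e : R3, is_derive (fun s => dot e (c s)) t (dot e v) /\
                           is_derive (fun s => dot e (d s)) t (dot e w)).
{ intros e; split; (apply is_derive_comp_R3; [|assumption]);
    apply filterdiff_linear, is_linear_dot. }
apply (is_derive_ext (fun s =>
   dot (vec3 1 0 0) (c s) * dot (vec3 1 0 0) (d s) + dot (vec3 0 1 0) (c s) * dot (vec3 0 1 0) (d s)
   + dot (vec3 0 0 1) (c s) * dot (vec3 0 0 1) (d s))).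
{ intros s; destruct (c s) as [[? ?] ?], (d s) as [[? ?] ?]; vec. }
evar_last.
- apply is_derive_Rplus; [apply is_derive_Rplus|];
    (apply is_derive_Rmult; [exact (proj1 (L _))|exact (proj2 (L _))]).
- cbv beta; destruct (c t) as [[? ?] ?], (d t) as [[? ?] ?], v as [[? ?] ?], w as [[? ?] ?]; vec.
Qed.

Lemma continuous_vec3 (T : UniformSpace) (x y z : T -> R) (p : T) :
  continuous x p -> continuous y p -> continuous z p ->
  continuous (U := R3) (fun s : T => vec3 (x s) (y s) (z s)) p.
Proof.
intros Hx Hy Hz.
apply (continuous_ext (T := T) (U := R3) (fun s =>
  plus (plus (scal (x s) (vec3 1 0 0)) (scal (y s) (vec3 0 1 0)))
                                 (scal (z s) (vec3 0 0 1)))).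
{ intros s; vec. }
apply (continuous_plus (V := R3)); [apply (continuous_plus (V := R3))|];
  apply (continuous_scal (V := R3)); auto using continuous_const.
Qed.

Lemma continuous_dot_fun (T : UniformSpace) (c d : T -> R3) (p : T) :
  continuous c p -> continuous d p -> continuous (fun s => dot (c s) (d s)) p.
Proof.
intros Hc Hd.
assert (L : forall e : R3, continuous (fun s => dot e (c s)) p /\
                           continuous (fun s => dot e (d s)) p).
{ intros e; split; (apply (continuous_comp _ (dot e)); [assumption|]); apply continuous_dot. }
apply (continuous_ext (fun s =>
   dot (vec3 1 0 0) (c s) * dot (vec3 1 0 0) (d s) + dot (vec3 0 1 0) (c s) * dot (vec3 0 1 0) (d s)
   + dot (vec3 0 0 1) (c s) * dot (vec3 0 0 1) (d s))).
{ intros s; destruct (c s) as [[? ?] ?], (d s) as [[? ?] ?]; vec. }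
apply continuous_Rplus; [apply continuous_Rplus|]; (apply continuous_Rmult; [exact (proj1 (L _))|exact (proj2 (L _))]).
Qed.

(** A partial derivative depends only on the values near the point; since U is open, x + t e stays
    in it for small t. *)
Lemma Ck_on_ext (k : nat) (U : R3 -> Prop) (F G : R3 -> R) :
  open U -> (forall x, U x -> F x = G x) -> Ck_on k U F -> Ck_on k U G.
Proof.
intros oU; revert F G; induction k as [|k IH]; intros F G E H.
- intros x Ux; apply (continuous_ext_loc G F).
  + generalize (oU x Ux); apply filter_imp; auto.
  + now apply H.
- assert (EL : forall e x, U x -> locally 0 (fun t : R => F (plus x (scal t e)) = G (plus x (scal t e)))).
  { intros e x Ux.
    assert (C : continuous (fun t : R => plus x (scal t e) : R3) 0).
    { apply (continuous_plus (V := R3)); [apply continuous_const|].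
      apply (continuous_scal (V := R3)); [apply continuous_id|apply continuous_const]. }
    apply (C (fun y => F y = G y)).
    replace (plus x (scal 0 e)) with x by (destruct x as [[? ?] ?], e as [[? ?] ?]; vec).
    generalize (oU x Ux); apply filter_imp; auto. }
  intros e Ie; destruct (H e Ie) as [H1 H2]; split.
  + intros x Ux; apply (ex_derive_ext_loc (fun t : R => F (plus x (scal t e)))); auto.
  + revert H2; apply IH.
    intros x Ux; apply Derive_ext_loc; auto.
Qed.

(** The constant c serves the induction: differentiating along e leaves a partial derivative of F
    minus the constant <e, w>, which is again of this form, with w = 0. *)
Lemma Ck_on_affine (k : nat) (U : R3 -> Prop) (F : R3 -> R) (w : R3) (c : R) :
  open U -> Ck_on k U F -> Ck_on k U (fun x => F x - dot x w + c).
Proof.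
intros oU; revert F w c; induction k as [|k IH]; intros F w c H.
- intros x Ux.
  apply continuous_Rplus; [|apply continuous_const].
  apply continuous_Rminus; [now apply H|].
  apply continuous_dot_fun; [apply continuous_id|apply continuous_const].
- intros e Ie; destruct (H e Ie) as [H1 H2].
  assert (D : forall x, U x -> is_derive (fun t : R => F (plus x (scal t e)) - dot (plus x (scal t e)) w + c) 0
             (Derive (fun t : R => F (plus x (scal t e))) 0 - dot e w)).
  { intros x Ux.
    apply (is_derive_ext (fun t : R => F (plus x (scal t e)) - (dot x w + t * dot e w) + c)).
    { intros t; do 2 f_equal; destruct x as [[? ?] ?], e as [[? ?] ?], w as [[? ?] ?]; vec. }
    apply (is_derive_ext (fun t : R => F (plus x (scal t e)) + (c - dot x w - t * dot e w))).
    { intros t; R_ring. }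
    apply is_derive_Rplus; [now apply Derive_correct, H1|auto_derive; [exact I|ring]]. }
  split.
  + intros x Ux; eexists; now apply D.
  + apply (Ck_on_ext k U (fun x =>
      Derive (fun t : R => F (plus x (scal t e))) 0 - dot x zero + - dot e w));
      [assumption| |now apply IH].
    intros x Ux; rewrite (is_derive_unique _ _ _ (D x Ux)).
    destruct x as [[? ?] ?]; vec_unfold; ring.
Qed.

(** [Ck_on] asks only the partial derivatives of highest order to be continuous. Continuity of the
    first-order ones is therefore a hypothesis here, which [Ck_on_continuous] provides by an
    induction that uses this lemma in its step. *)
Lemma Ck_on_filterdiff (k : nat) (U : R3 -> Prop) (F : R3 -> R) (x : R3) :
  (forall G, Ck_on k U G -> Ck_on 0 U G) -> open U -> Ck_on (S k) U F -> U x ->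
  filterdiff (V := R_NormedModule) F (locally x) (dot (gradient F x)).
Proof.
intros H0 oU H Ux; apply (filterdiff_gradient F U); auto.
intros e Ie; destruct (H e Ie) as [H1 H2]; split; [assumption|].
now apply H0.
Qed.

Lemma Ck_on_continuous (k : nat) (U : R3 -> Prop) (F : R3 -> R) :
  open U -> Ck_on k U F -> Ck_on 0 U F.
Proof.
intros oU; revert F; induction k as [|k IH]; intros F H; [assumption|].
intros x Ux; apply (filterdiff_continuous F).
eexists; now apply (Ck_on_filterdiff k U).
Qed.

Lemma Ck_on_pred (k : nat) (U : R3 -> Prop) (F : R3 -> R) :
  open U -> Ck_on (S k) U F -> Ck_on k U F.
Proof.
intros oU; revert F; induction k as [|k IH]; intros F H.
- now apply (Ck_on_continuous 1).
- intros e Ie; destruct (H e Ie) as [H1 H2]; split; [assumption|now apply IH].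
Qed.

Lemma Ck_on_is_derive (k : nat) (U : R3 -> Prop) (F : R3 -> R) (c : R -> R3) (t : R) (v : R3) :
  open U -> Ck_on (S k) U F -> U (c t) -> is_derive c t v ->
  is_derive (fun s => F (c s)) t (dot (gradient F (c t)) v).
Proof.
intros oU H Ut; apply is_derive_comp_R3.
apply (Ck_on_filterdiff k U); auto.
intros G; now apply Ck_on_continuous.
Qed.

Lemma Ck_on_gradient (k : nat) (U : R3 -> Prop) (F : R3 -> R) (x : R3) :
  open U -> Ck_on (S k) U F -> U x -> continuous (gradient F) x.
Proof.
intros oU H Ux; apply continuous_vec3;
  (eapply Ck_on_continuous; [exact oU| |exact Ux]; apply H);
  [now left | now right; left | now right; right; left].
Qed.

(** * Differentiation on the sphere *)

Lemma sin2_cos2_eq (t : R) : sin t * sin t = 1 - cos t * cos t.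
Proof. generalize (sin2_cos2 t); unfold Rsqr; lra. Qed.

(* Rodrigues' formula; e is a unit vector. *)
Definition rotation (e p : R3) (t : R) : R3 :=
  plus (plus (scal (cos t) p) (scal (sin t) (cross e p))) (scal ((1 - cos t) * dot e p) e).

Lemma S2_rotation (e p : R3) (t : R) : In e basis3 -> S2 p -> S2 (rotation e p t).
Proof.
destruct p as [[x y] z]; unfold S2; intros Ie Hp.
assert (E : (sin t * sin t + cos t * cos t) = 1) by (rewrite sin2_cos2_eq; ring).
destruct Ie as [<-|[<-|[<-|[]]]]; unfold rotation; vec_unfold; vm_compute in Hp;
change (x * x + y * y + z * z = 1) in Hp.
- match goal with |- ?A = 1 => replace A with
    (x * x + (sin t * sin t + cos t * cos t) * (y * y + z * z)) by R_ring end.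
  rewrite E; lra.
- match goal with |- ?A = 1 => replace A with
    (y * y + (sin t * sin t + cos t * cos t) * (x * x + z * z)) by R_ring end.
  rewrite E; lra.
- match goal with |- ?A = 1 => replace A with
    (z * z + (sin t * sin t + cos t * cos t) * (x * x + y * y)) by R_ring end.
  rewrite E; lra.
Qed.

Lemma is_derive_rotation (e p : R3) : is_derive (rotation e p) 0 (cross e p).
Proof.
destruct e as [[a b] c], p as [[x y] z].
apply (is_derive_ext (V := R3) (fun t => vec3
  (cos t * x + sin t * (b * z - c * y) + (1 - cos t) * (a * x + b * y + c * z) * a)
  (cos t * y + sin t * (c * x - a * z) + (1 - cos t) * (a * x + b * y + c * z) * b)
  (cos t * z + sin t * (a * y - b * x) + (1 - cos t) * (a * x + b * y + c * z) * c))).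
{ intros t; unfold rotation; vec. }
apply is_derive_vec3; (auto_derive; [auto|rewrite sin_0, cos_0; simpl; R_ring]).
Qed.

(* The derivatives of f along the rotations about the axes; this is p x grad f(p)
   for any extension of f to a neighbourhood of p. *)
Definition momentum (f : R3 -> R) (p : R3) : R3 :=
  vec3 (Derive (fun t => f (rotation (vec3 1 0 0) p t)) 0)
       (Derive (fun t => f (rotation (vec3 0 1 0) p t)) 0)
       (Derive (fun t => f (rotation (vec3 0 0 1) p t)) 0).

(** Rotations keep p on the sphere, where F and f agree, so the chain rule gives grad F . (e x p) =
    e . (p x grad F). In particular the right-hand side is the same for all extensions. *)
Lemma momentum_gradient (k : nat) (U : R3 -> Prop) (f F : R3 -> R) (p : R3) :
  open U -> Ck_on (S k) U F -> (forall x, U x -> S2 x -> F x = f x) -> U p -> S2 p ->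
  momentum f p = cross p (gradient F p).
Proof.
intros oU HF E Up Sp.
assert (D : forall e, In e basis3 ->
  Derive (fun t => f (rotation e p t)) 0 = dot (gradient F p) (cross e p)).
{ intros e Ie; apply is_derive_unique.
  assert (R0 : rotation e p 0 = p).
  { unfold rotation; rewrite sin_0, cos_0.
    destruct e as [[? ?] ?], p as [[? ?] ?]; vec. }
  apply (is_derive_ext_loc (fun t => F (rotation e p t))).
  - assert (C : continuous (rotation e p) 0).
    { apply (ex_derive_continuous (V := R3) (rotation e p)); eexists; apply is_derive_rotation. }
    assert (L := C _ (eq_ind_r (fun q => locally q U) (oU p Up) R0)).
    revert L; unfold filtermap; apply filter_imp; intros t Ut; apply E; [assumption|].
    now apply S2_rotation.
  - assert (H := Ck_on_is_derive k U F (rotation e p) 0 (cross e p) oU HF).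
    rewrite R0 in H; apply H; [assumption|apply is_derive_rotation]. }
unfold momentum; rewrite !D by (simpl; tauto).
generalize (gradient F p); intros [[? ?] ?]; destruct p as [[? ?] ?]; vec.
Qed.

Lemma S2_curve_orthogonal (c : R -> R3) (t : R) (v : R3) :
  (forall s, S2 (c s)) -> is_derive c t v -> dot (c t) v = 0.
Proof.
intros Sc Hc.
assert (H := is_derive_unique _ _ _ (is_derive_dot c c t v v Hc Hc)).
rewrite (Derive_ext _ (fun _ => 1)) in H by exact Sc.
rewrite Derive_const in H.
assert (E : dot v (c t) = dot (c t) v) by (destruct v as [[? ?] ?], (c t) as [[? ?] ?]; vec).
lra.
Qed.

(** A chain rule free of extensions; every first derivative below is an instance of it. *)
Lemma is_derive_S2 (k : nat) (f : R3 -> R) (c : R -> R3) (t : R) (v : R3) :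
  Ck_S2 (S k) f -> (forall s, S2 (c s)) -> is_derive c t v ->
  is_derive (fun s => f (c s)) t (dot (momentum f (c t)) (cross (c t) v)).
Proof.
intros Hf Sc Hc.
destruct (Hf (c t) (Sc t)) as [U [F [oU [Ut [HF E]]]]].
rewrite (momentum_gradient k U f F (c t)); auto.
apply (is_derive_ext_loc (fun s => F (c s))).
{ assert (C : continuous c t).
  { apply (ex_derive_continuous (V := R3) c); exists v; exact Hc. }
  generalize (C _ (oU _ Ut)); unfold filtermap; apply filter_imp; auto. }
replace (dot _ _) with (dot (gradient F (c t)) v).
{ now apply (Ck_on_is_derive k U). }
(* Lagrange's identity for <c x grad F, c x v>; its second product vanishes because the velocity v
   is orthogonal to c on the sphere. *)
transitivity (dot (c t) (c t) * dot (gradient F (c t)) v - dot (c t) v * dot (c t) (gradient F (c t))).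
{ rewrite (S2_curve_orthogonal c t v Sc Hc), (Sc t); ring. }
generalize (gradient F (c t)); intros [[? ?] ?]; destruct (c t) as [[? ?] ?], v as [[? ?] ?]; vec.
Qed.

Lemma continuous_S2 (k : nat) (f : R3 -> R) (T : UniformSpace) (c : T -> R3) (x : T) :
  Ck_S2 k f -> (forall s, S2 (c s)) -> continuous c x -> continuous (fun s => f (c s)) x.
Proof.
intros Hf Sc Hc.
destruct (Hf (c x) (Sc x)) as [U [F [oU [Ux [HF E]]]]].
apply (continuous_ext_loc _ (fun s => F (c s))).
{ generalize (Hc _ (oU _ Ux)); unfold filtermap; apply filter_imp; auto. }
apply (continuous_comp c F); [assumption|].
now apply (Ck_on_continuous k U).
Qed.

Lemma continuous_cross (T : UniformSpace) (c d : T -> R3) (x : T) :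
  continuous c x -> continuous d x -> continuous (fun s => cross (c s) (d s)) x.
Proof.
intros Hc Hd.
assert (L : forall (a : T -> R3) (e : R3), continuous a x -> continuous (fun s => dot e (a s)) x).
{ intros a e Ha; apply (continuous_comp _ (dot e)); [assumption|]; apply continuous_dot. }
apply (continuous_ext (T := T) (U := R3) (fun s => vec3
  (dot (vec3 0 1 0) (c s) * dot (vec3 0 0 1) (d s) - dot (vec3 0 0 1) (c s) * dot (vec3 0 1 0) (d s))
  (dot (vec3 0 0 1) (c s) * dot (vec3 1 0 0) (d s) - dot (vec3 1 0 0) (c s) * dot (vec3 0 0 1) (d s))
  (dot (vec3 1 0 0) (c s) * dot (vec3 0 1 0) (d s) - dot (vec3 0 1 0) (c s) * dot (vec3 1 0 0) (d s)))).
{ intros s; destruct (c s) as [[? ?] ?], (d s) as [[? ?] ?]; vec. }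
apply continuous_vec3; apply continuous_Rminus; apply continuous_Rmult; apply L; assumption.
Qed.

Lemma continuous_momentum (k : nat) (f : R3 -> R) (T : UniformSpace) (c : T -> R3) (x : T) :
  Ck_S2 (S k) f -> (forall s, S2 (c s)) -> continuous c x ->
  continuous (fun s => momentum f (c s)) x.
Proof.
intros Hf Sc Hc.
destruct (Hf (c x) (Sc x)) as [U [F [oU [Ux [HF E]]]]].
apply (continuous_ext_loc _ (fun s => cross (c s) (gradient F (c s)))).
{ generalize (Hc _ (oU _ Ux)); unfold filtermap; apply filter_imp.
  intros s Us; symmetry; now apply (momentum_gradient k U). }
apply continuous_cross; [assumption|].
apply (continuous_comp c (gradient F)); [assumption|].
now apply (Ck_on_gradient k U).
Qed.

Lemma S2_circle_point (omega u : R3) (t : R) :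
  S2 omega -> great_circle omega u -> S2 (circle_point omega u t).
Proof.
unfold S2, great_circle; intros Hw [Hu Ho].
transitivity (cos t * cos t * dot u u + sin t * sin t * (dot omega omega * dot u u - dot omega u * dot omega u)).
{ destruct omega as [[? ?] ?], u as [[? ?] ?]; vec. }
unfold S2 in Hu; rewrite sin2_cos2_eq, Hw, Hu, Ho; ring.
Qed.

Lemma is_derive_circle_point (omega u : R3) (t : R) :
  is_derive (circle_point omega u) t
    (plus (scal (- sin t) u) (scal (cos t) (cross omega u))).
Proof.
apply (is_derive_plus (V := R3) (fun s => scal (cos s) u) (fun s => scal (sin s) (cross omega u))).
- apply (is_derive_scal_l (V := R3) cos t (- sin t) u).
  apply is_derive_Reals, derivable_pt_lim_cos.
- apply (is_derive_scal_l (V := R3) sin t (cos t) (cross omega u)).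
  apply is_derive_Reals, derivable_pt_lim_sin.
Qed.

Lemma cross_circle_point (omega u : R3) (t : R) :
  S2 omega -> great_circle omega u ->
  cross omega (circle_point omega u t) = plus (scal (- sin t) u) (scal (cos t) (cross omega u)).
Proof.
intros Hw [Hu Ho].
transitivity (plus (plus (scal (- sin t * dot omega omega) u) (scal (cos t) (cross omega u)))
                (scal (sin t * dot omega u) omega)).
{ destruct omega as [[? ?] ?], u as [[? ?] ?]; vec. }
unfold S2 in Hw; rewrite Hw, Ho.
destruct omega as [[? ?] ?], u as [[? ?] ?]; vec.
Qed.

Lemma great_circle_circle_point (omega u : R3) (t : R) :
  S2 omega -> great_circle omega u -> great_circle omega (circle_point omega u t).
Proof.
intros Hw Hu; split; [now apply S2_circle_point|].
destruct Hu as [_ Ho].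
transitivity (cos t * dot omega u); [|rewrite Ho; ring].
destruct omega as [[? ?] ?], u as [[? ?] ?]; vec.
Qed.

Lemma cross_great_circle (omega u : R3) :
  S2 omega -> great_circle omega u -> cross u (cross omega u) = omega.
Proof.
intros Hw [Hu Ho].
transitivity (plus (scal (dot u u) omega) (scal (- dot omega u) u)).
{ destruct omega as [[? ?] ?], u as [[? ?] ?]; vec. }
unfold S2 in Hu; rewrite Hu, Ho.
destruct omega as [[? ?] ?], u as [[? ?] ?]; vec.
Qed.

(** The point n moves along the circle with velocity omega x n, and n x (omega x n) = omega, so the
    derivative is the component of the momentum along the axis. *)
Lemma is_derive_on_circle (k : nat) (f : R3 -> R) (omega u : R3) (t : R) :
  Ck_S2 (S k) f -> S2 omega -> great_circle omega u ->
  is_derive (fun s => f (circle_point omega u s)) t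
    (dot (momentum f (circle_point omega u t)) omega).
Proof.
intros Hf Hw Hu.
rewrite <- (cross_great_circle omega (circle_point omega u t)) at 2;
  [|assumption|now apply great_circle_circle_point].
apply (is_derive_S2 k); [assumption|now intros; apply S2_circle_point|].
rewrite cross_circle_point by assumption.
apply is_derive_circle_point.
Qed.

(** Near each t the first derivative is <grad F(c), c'> for a local extension F, to which the
    product rule applies, with c'' = - c. *)
Lemma is_derive2_on_circle (k : nat) (f : R3 -> R) (omega u : R3) :
  Ck_S2 (S (S k)) f -> S2 omega -> great_circle omega u ->
  exists h2 : R -> R,
    (forall t, is_derive (fun s => dot (momentum f (circle_point omega u s)) omega) t (h2 t)) /\
    (forall t, continuous h2 t).
Proof.
intros Hf Hw Hu.
set (c := circle_point omega u).
set (c' := fun s => cross omega (c s)).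
assert (Dc : forall s, is_derive c s (c' s)).
{ intros s; unfold c', c; rewrite cross_circle_point by assumption.
  apply is_derive_circle_point. }
assert (Sc : forall s, S2 (c s)) by (intros s; now apply S2_circle_point).
assert (Cc : forall s, continuous c s).
{ intros s; apply (ex_derive_continuous (V := R3) c); eexists; apply Dc. }
assert (Cc' : forall s, continuous c' s).
{ intros s; apply continuous_cross; [apply continuous_const|apply Cc]. }
assert (Dc' : forall s, is_derive c' s (opp (c s))).
{ intros s.
  apply (is_derive_ext (V := R3) (fun r => plus (scal (- sin r) u) (scal (cos r) (cross omega u)))).
  { intros r; unfold c', c; symmetry; now apply cross_circle_point. }
  replace (opp (c s)) with (plus (scal (- cos s) u) (scal (- sin s) (cross omega u))).
  - apply (is_derive_plus (V := R3) (fun s => scal (- sin s) u) (fun s => scal (cos s) (cross omega u))).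
    + apply (is_derive_scal_l (V := R3) (fun s => - sin s) s (- cos s) u).
      auto_derive; [exact I|ring].
    + apply (is_derive_scal_l (V := R3) cos s (- sin s) (cross omega u)).
      auto_derive; [exact I|ring].
  - unfold c, circle_point; generalize (cross omega u); intros [[? ?] ?].
    destruct u as [[? ?] ?]; vec. }
exists (Derive (fun s => dot (momentum f (c s)) omega)).
(* The formula g depends on the extension chosen near t. [Derive] glues these formulas together, and
   inherits its continuity from them because continuity is local. *)
assert (L : forall t, exists g : R -> R,
  locally t (fun s => is_derive (fun s => dot (momentum f (c s)) omega) s (g s)) /\
  continuous g t).
{ intros t.
  destruct (Hf (c t) (Sc t)) as [U [F [oU [Ut [HF E]]]]].
  assert (LU : locally t (fun s => U (c s))) by exact (Cc t _ (oU _ Ut)).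
  assert (P1 : In (vec3 1 0 0) basis3) by (simpl; tauto).
  assert (P2 : In (vec3 0 1 0) basis3) by (simpl; tauto).
  assert (P3 : In (vec3 0 0 1) basis3) by (simpl; tauto).
  set (G := fun s => vec3 (dot (gradient (partial (vec3 1 0 0) F) (c s)) (c' s))
                          (dot (gradient (partial (vec3 0 1 0) F) (c s)) (c' s))
                          (dot (gradient (partial (vec3 0 0 1) F) (c s)) (c' s))).
  exists (fun s => dot (G s) (c' s) + dot (gradient F (c s)) (opp (c s))).
  split.
  - generalize (locally_locally _ _ LU); apply filter_imp.
    intros s Ls.
    assert (Us := locally_singleton _ _ Ls).
    apply (is_derive_ext_loc (fun r => dot (gradient F (c r)) (c' r))).
    { revert Ls; apply filter_imp; intros r Ur.
      rewrite (momentum_gradient (S k) U f F (c r)) by auto.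
      unfold c'; generalize (gradient F (c r)); intros [[? ?] ?].
      destruct (c r) as [[? ?] ?], omega as [[? ?] ?]; vec. }
    apply is_derive_dot; [|apply Dc'].
    unfold gradient, G.
    apply is_derive_vec3; (apply (Ck_on_is_derive k U); [assumption|now apply HF|assumption|apply Dc]).
  - assert (CG : forall e, In e basis3 ->
      continuous (fun s => dot (gradient (partial e F) (c s)) (c' s)) t).
    { intros e Ie; apply continuous_dot_fun; [|apply Cc'].
      apply (continuous_comp c (gradient (partial e F))); [apply Cc|].
      now apply (Ck_on_gradient k U); [|apply HF|]. }
    apply continuous_Rplus; apply continuous_dot_fun.
    + apply continuous_vec3; now apply CG.
    + apply Cc'.
    + apply (continuous_comp c (gradient F)); [apply Cc|].
      now apply (Ck_on_gradient (S k) U).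
    + apply (continuous_opp (V := R3)), Cc. }
split; intros t; destruct (L t) as [g [Lg Cg]].
- apply Derive_correct; eexists; exact (locally_singleton _ _ Lg).
- apply (continuous_ext_loc _ g); [|exact Cg].
  revert Lg; apply filter_imp; intros s Ls; symmetry; now apply is_derive_unique.
Qed.

(** * Integrals depending on a parameter *)

(** The parameter space is arbitrary so that the parameter may be a pair of angles, as for the
    averages over the longitude. *)
Definition continuous2 {T : UniformSpace} (f : T -> R -> R) : Prop :=
  forall q : T * R, continuous (fun q : T * R => f (fst q) (snd q)) q.

Lemma continuous2_r (T : UniformSpace) (f : T -> R -> R) (x : T) (t : R) :
  continuous2 f -> continuous (f x) t.
Proof.
intros H.
apply (continuous_comp (fun t : R => (x, t)) (fun q : T * R => f (fst q) (snd q))); [|apply H].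
intros P [e He]; exists e; intros s Hs; apply He; split; [apply ball_center|exact Hs].
Qed.

Lemma continuous2_comp (T T' : UniformSpace) (f : T -> R -> R) (g : T' -> T) (h : T' -> R) (x : T') :
  continuous2 f -> continuous g x -> continuous h x -> continuous (fun s => f (g s) (h s)) x.
Proof. intros H Hg Hh; apply continuous_comp_2; [assumption..|exact (H (g x, h x))]. Qed.

Lemma ex_RInt_everywhere (f : R -> R) (a b : R) : (forall t, continuous f t) -> ex_RInt f a b.
Proof. intros H; apply (ex_RInt_continuous (V := R_CompleteNormedModule)); auto. Qed.

Lemma continuous_RInt_param (T : UniformSpace) (f : T -> R -> R) (a b : R) (p : T) :
  continuous2 f -> continuous (fun x => RInt (f x) a b) p.
Proof.
intros H.
assert (X : forall x s r, ex_RInt (f x) s r).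
{ intros x s r; apply ex_RInt_everywhere; intros t; now apply continuous2_r. }
assert (M : forall a b, a <= b -> continuous (fun x => RInt (f x) a b) p).
2:{ destruct (Rle_dec a b) as [h|h]; [now apply M|].
    apply (continuous_ext (fun x => opp (RInt (f x) b a))).
    { intros x; apply opp_RInt_swap, X. }
    apply (continuous_opp (V := R_NormedModule) (fun x => RInt (f x) b a)), M; lra. }
clear a b; intros a b ab.
apply (filterlim_locally (fun x => RInt (f x) a b)); intros eps.
(* The integrands will differ by at most 2e, hence the integrals by (b - a) 2e < eps; the 1 avoids a
   division by zero when a = b. *)
assert (He : 0 < eps / (4 * (b - a + 1))).
{ apply Rdiv_lt_0_compat; [apply cond_pos|lra]. }
set (e := mkposreal _ He).
assert (L : forall t : R, {d : posreal | forall q : T * R, ball (p, t) d q -> Rabs (f (fst q) (snd q) - f p t) < e}).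
{ intros t; apply constructive_indefinite_description.
  exact (proj1 (filterlim_locally _ _) (H (p, t)) e). }
(* Compactness of [a, b] gives a radius d valid for all s: both (x, s) and (p, s) are close to some
   (p, t), which costs e twice. The conclusion holds only under a double negation, hence the
   argument by contradiction in [K]. *)
destruct (compactness_value_1d a b (fun t => proj1_sig (L t))) as [d Hd].
exists d; intros x Bx.
assert (K : forall s, a <= s <= b -> Rabs (f x s - f p s) <= 2 * e).
{ intros s Hs; apply Rnot_lt_le; intros N.
  apply (Hd s Hs); intros [t [_ [Hst Hdt]]].
  destruct (L t) as [dt Ht]; simpl in *.
  assert (H1 := Ht (x, s) (conj (ball_le _ _ _ Hdt _ Bx) Hst)).
  assert (H2 := Ht (p, s) (conj (ball_center p dt) Hst)).
  simpl in H1, H2.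
  apply Rabs_def2 in H1; apply Rabs_def2 in H2.
  revert N; apply Rle_not_lt; apply Rabs_le; lra. }
change (Rabs (RInt (f x) a b - RInt (f p) a b) < eps).
change (RInt (f x) a b - RInt (f p) a b) with (minus (RInt (f x) a b) (RInt (f p) a b)).
rewrite <- (RInt_minus (V := R_CompleteNormedModule)) by apply X.
apply Rle_lt_trans with ((b - a) * (2 * e)).
- apply (norm_RInt_le_const (V := R_NormedModule) (fun s => minus (f x s) (f p s)) a b); auto.
  apply (RInt_correct (V := R_CompleteNormedModule)), (ex_RInt_minus (V := R_NormedModule)); apply X.
- unfold e; simpl.
  apply Rmult_lt_reg_r with (4 * (b - a + 1)); [lra|].
  replace (_ * _ * _) with ((b - a) * 2 * eps) by (field; lra).
  generalize (cond_pos eps); intros; nra.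
Qed.

Lemma is_derive_RInt_under (f df : R -> R -> R) (a b x : R) :
  (forall x t, is_derive (fun s => f s t) x (df x t)) ->
  (forall x t, continuous (f x) t) -> continuous2 df ->
  is_derive (fun s => RInt (f s) a b) x (RInt (df x) a b).
Proof.
intros D Cf Cd.
assert (E : forall x t, Derive (fun s => f s t) x = df x t).
{ intros; now apply is_derive_unique. }
rewrite <- (RInt_ext (fun t => Derive (fun s => f s t) x)) by auto.
apply is_derive_RInt_param.
- apply filter_forall; intros s t _; eexists; apply D.
- intros t _; apply continuity_2d_pt_filterlim.
  apply (continuous_ext (T := prod_UniformSpace R_UniformSpace R_UniformSpace) (fun q => df (fst q) (snd q))).
  { intros q; now rewrite E. }
  exact (Cd (x, t)).
- apply filter_forall; intros s; now apply ex_RInt_everywhere.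
Qed.

Lemma continuous2_swap (f : R -> R -> R) :
  continuous2 (T := R_UniformSpace) f -> continuous2 (T := R_UniformSpace) (fun y x => f x y).
Proof.
intros H q.
apply (continuous2_comp R_UniformSpace _ f snd fst); [assumption|apply continuous_snd|apply continuous_fst].
Qed.

(** Fubini for continuous integrands: when the upper bound b becomes a variable x, both sides vanish
    at a and have the same derivative, the integral of [f x] over [c, d]. *)
Lemma RInt_swap_order (f : R -> R -> R) (a b c d : R) :
  continuous2 (T := R_UniformSpace) f -> a < b ->
  RInt (fun x => RInt (f x) c d) a b = RInt (fun y => RInt (fun x => f x y) a b) c d.
Proof.
intros H ab.
assert (H' := continuous2_swap f H).
assert (C : forall x, continuous (fun x => RInt (f x) c d) x).
{ intros x; now apply (continuous_RInt_param R_UniformSpace). }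
set (D := fun x => RInt (fun x => RInt (f x) c d) a x - RInt (fun y => RInt (fun x => f x y) a x) c d).
assert (E : D a = D b).
{ apply (eq_is_derive (V := R_NormedModule) D); [intros x _|assumption].
  replace (zero : R_NormedModule) with (RInt (f x) c d - RInt (f x) c d) by apply Rminus_diag.
  apply (is_derive_minus (V := R_NormedModule)).
  - apply (is_derive_RInt (V := R_NormedModule) (fun x => RInt (f x) c d) _ a); [|apply C].
    apply filter_forall; intros y; apply (RInt_correct (V := R_CompleteNormedModule)).
    now apply ex_RInt_everywhere.
  - apply (is_derive_RInt_under (fun x y => RInt (fun x => f x y) a x) f).
    + intros z t.
      apply (is_derive_RInt (V := R_NormedModule) (fun x => f x t) _ a).
      * apply filter_forall; intros y; apply (RInt_correct (V := R_CompleteNormedModule)).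
        apply ex_RInt_everywhere; intros; now apply (continuous2_r R_UniformSpace (fun y x => f x y)).
      * now apply (continuous2_r R_UniformSpace (fun y x => f x y)).
    + intros z t; now apply (continuous_RInt_param R_UniformSpace (fun y x => f x y)).
    + exact H. }
unfold D in E.
rewrite RInt_point, (RInt_ext (fun y => RInt (fun x => f x y) a a) (fun _ => 0)), RInt_const in E
  by (intros; apply (RInt_point (V := R_CompleteNormedModule))).
unfold scal, zero in E; simpl in E; unfold mult in E; simpl in E.
lra.
Qed.

Lemma RInt_shift (g : R -> R) (a b c : R) :
  (forall t, continuous g t) -> RInt (fun t => g (t + c)) a b = RInt g (a + c) (b + c).
Proof.
intros Cg.
assert (H := RInt_comp_lin (V := R_CompleteNormedModule) g 1 c a b (ex_RInt_everywhere _ _ _ Cg)).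
rewrite !Rmult_1_l in H; rewrite <- H.
apply RInt_ext; intros t _; unfold scal; simpl; unfold mult; simpl.
now rewrite !Rmult_1_l.
Qed.

(** The part of [c, p + c] beyond p is the translate by p of the part of [0, p] that is missing. *)
Lemma RInt_period (g : R -> R) (p c : R) :
  (forall t, continuous g t) -> (forall t, g (t + p) = g t) ->
  RInt (fun t => g (t + c)) 0 p = RInt g 0 p.
Proof.
intros Cg P.
assert (X : forall a b, ex_RInt g a b) by (intros; now apply ex_RInt_everywhere).
rewrite RInt_shift, Rplus_0_l by assumption.
rewrite <- (RInt_Chasles g c p (p + c)) by apply X.
rewrite <- (RInt_Chasles g 0 c p) by apply X.
assert (E := RInt_shift g 0 c p Cg).
rewrite Rplus_0_l, (Rplus_comm c p) in E; rewrite <- E.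
rewrite (RInt_ext (fun t => g (t + p)) g) by auto.
apply Rplus_comm.
Qed.

(** * Curvature radii of the projections *)

Lemma support_reference (B : R3 -> Prop) (O u : R3) :
  convex_body B -> support B O u = support B zero u - dot u O.
Proof.
intros HB.
destruct (support_max B O u HB) as [[y [By Ey]] My].
destruct (support_max B zero u HB) as [[z [Bz Ez]] Mz].
specialize (My z Bz); specialize (Mz y By).
rewrite !dot_minus in *.
assert (E : dot u zero = 0) by (destruct u as [[? ?] ?]; vec).
lra.
Qed.

Lemma Ck_S2_support (k : nat) (B : R3 -> Prop) (O : R3) :
  convex_body B -> smooth_body k B -> Ck_S2 k (support B O).
Proof.
intros HB H p Sp.
destruct (H p Sp) as [U [F [oU [Up [HF E]]]]].
exists U, (fun x => F x - dot x O + 0); repeat split; auto.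
- now apply Ck_on_affine.
- intros x Ux Sx; rewrite support_reference, E by assumption; ring.
Qed.

Lemma Ck_S2_pred (k : nat) (f : R3 -> R) : Ck_S2 (S k) f -> Ck_S2 k f.
Proof.
intros H p Sp.
destruct (H p Sp) as [U [F [oU [Up [HF E]]]]].
exists U, F; repeat split; auto.
now apply Ck_on_pred.
Qed.

Lemma is_derive_minimum (g : R -> R) (x l : R) :
  is_derive g x l -> (forall y, g x <= g y) -> l = 0.
Proof.
intros D M.
assert (X : ex_derive g x) by now exists l.
rewrite <- (is_derive_unique _ _ _ D).
rewrite <- (Derive_Reals _ _ (ex_derive_Reals_0 _ _ X)).
apply (deriv_minimum g (x - 1) (x + 1)); auto; lra.
Qed.

(** If l were negative, g' would be negative immediately to the right of x, and g would fall below
    its minimum by the mean value theorem. *)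
Lemma is_derive2_minimum (g g' : R -> R) (x l : R) :
  (forall t, is_derive g t (g' t)) -> is_derive g' x l -> (forall y, g x <= g y) -> 0 <= l.
Proof.
intros D D' M.
assert (Z : g' x = 0) by now apply (is_derive_minimum g x).
apply Rnot_lt_le; intros Hl.
apply is_derive_Reals in D'.
destruct (D' (- l)) as [d Hd]; [lra|].
assert (Hd0 := cond_pos d).
destruct (MVT_cor2 g g' x (x + d / 2)) as [c [E Hc]]; [lra| |].
{ intros; now apply is_derive_Reals. }
specialize (M (x + d / 2)).
assert (H := Hd (c - x)).
replace (x + (c - x)) with c in H by ring.
rewrite Z, Rminus_0_r, Rabs_pos_eq in H by lra.
specialize (H ltac:(lra) ltac:(lra)).
apply Rabs_def2 in H.
assert (g' c / (c - x) * (c - x) = g' c) by (field; lra).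
assert (g' c < 0) by nra.
nra.
Qed.

(* A planar vector orthogonal to n is a multiple of the normal omega x n of n. *)
Lemma length3_orthogonal (omega n v : R3) :
  S2 omega -> great_circle omega n -> dot omega v = 0 -> dot n v = 0 ->
  length3 v = Rabs (dot (cross omega n) v).
Proof.
intros Hw [Hn Ho] H1 H2; unfold length3.
rewrite <- sqrt_Rsqr_abs; f_equal; unfold Rsqr.
transitivity ((dot omega omega * dot n n - dot omega n * dot omega n) * dot v v).
{ unfold S2 in *; rewrite Hw, Hn, Ho; ring. }
(* Up to sign this is (omega x n) x v, so the next equality is Lagrange's identity for omega x n and
   v. *)
set (w := plus (scal (dot n v) omega) (opp (scal (dot omega v) n)) : R3).
transitivity (dot (cross omega n) v * dot (cross omega n) v + dot w w).
{ unfold w; destruct omega as [[? ?] ?], n as [[? ?] ?], v as [[? ?] ?]; vec. }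
replace w with (zero : R3).
{ vec. }
unfold w; rewrite H1, H2; destruct omega as [[? ?] ?], n as [[? ?] ?]; vec.
Qed.

Lemma circle_point_0 (omega u : R3) : circle_point omega u 0 = u.
Proof.
unfold circle_point; rewrite cos_0, sin_0.
destruct omega as [[? ?] ?], u as [[? ?] ?]; vec.
Qed.

(** Let q be the contact point. Then h = <n, q> and h' = <n', q>. Differentiating the first at 0
    gives <n, v> = 0, differentiating the second gives h'' + h = <n', v>. So v has only its
    component along n', whose sign must be known because the radius is a length. *)
Lemma projection_curvature_radius (B : R3 -> Prop) (O omega u : R3) (r h2 : R) :
  convex_body B -> Ck_S2 2 (support B O) -> S2 omega -> great_circle omega u ->
  is_curvature_radius (projection B omega) omega u r ->
  is_derive (fun s => dot (momentum (support B O) (circle_point omega u s)) omega) 0 h2 ->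
  r = support B O u + h2.
Proof.
intros HB Hf Hw Hu [p [v [Hp [Dp ->]]]] Dh2.
set (n := circle_point omega u) in *.
set (n' := fun s => cross omega (n s)).
set (h := fun s => support B O (n s)).
set (h' := fun s => dot (momentum (support B O) (n s)) omega) in *.
set (q := fun s => minus (p s) O : R3).
change (is_derive h' 0 h2) in Dh2.
assert (Gn : forall s, great_circle omega (n s)).
{ intros; now apply great_circle_circle_point. }
assert (proj : forall s y, dot (n s) (minus y (scal (dot omega y) omega)) = dot (n s) y).
{ intros s y; transitivity (dot (n s) y - dot omega y * dot omega (n s)).
  - generalize (n s); intros [[? ?] ?]; destruct omega as [[? ?] ?], y as [[? ?] ?]; vec.
  - rewrite (proj2 (Gn s)); ring. }
assert (op : forall s, dot omega (p s) = 0).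
{ intros s; destruct (Hp s) as [[y [By ->]] _].
  transitivity (dot omega y - dot omega y * dot omega omega).
  - destruct omega as [[? ?] ?], y as [[? ?] ?]; vec.
  - unfold S2 in Hw; rewrite Hw; ring. }
(* For fixed s, h - <n, q s> is minimal at s: this gives h' = <n', q>, and that
   the second derivative h2 + h, i.e. <n', v>, is nonnegative. *)
assert (le : forall s t, dot (n t) (q s) <= h t).
{ intros s t; unfold q, h; rewrite dot_minus.
  destruct (Hp s) as [[y [By E]] _]; rewrite E, proj, <- dot_minus.
  now apply (support_max B O (n t) HB). }
assert (eq : forall s, h s = dot (n s) (q s)).
{ intros s; apply Rle_antisym; [|apply le].
  destruct (proj1 (support_max B O (n s) HB)) as [z [Bz Ez]].
  unfold h, q; rewrite Ez, !dot_minus.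
  apply Rplus_le_compat_r; rewrite <- proj.
  apply (Hp s); now exists z. }
assert (Dn : forall s, is_derive n s (n' s)).
{ intros s; unfold n', n; rewrite cross_circle_point by assumption.
  apply is_derive_circle_point. }
assert (Dn' : is_derive n' 0 (opp (n 0))).
{ apply (is_derive_ext (V := R3) (fun s => vec3
    (dot (cross (vec3 1 0 0) omega) (n s)) (dot (cross (vec3 0 1 0) omega) (n s))
    (dot (cross (vec3 0 0 1) omega) (n s)))).
  { intros s; unfold n'; generalize (n s); intros [[? ?] ?]; destruct omega as [[? ?] ?]; vec. }
  replace (opp (n 0)) with (vec3 (dot (cross (vec3 1 0 0) omega) (n' 0))
     (dot (cross (vec3 0 1 0) omega) (n' 0)) (dot (cross (vec3 0 0 1) omega) (n' 0))).
  - apply is_derive_vec3; (apply is_derive_comp_R3; [apply filterdiff_linear, is_linear_dot|apply Dn]).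
  - transitivity (plus (opp (scal (dot omega omega) (n 0))) (scal (dot omega (n 0)) omega)).
    + unfold n'; generalize (n 0); intros [[? ?] ?]; destruct omega as [[? ?] ?]; vec.
    + rewrite (proj2 (Gn 0)); unfold S2 in Hw; rewrite Hw.
      generalize (n 0); intros [[? ?] ?]; destruct omega as [[? ?] ?]; vec. }
assert (Dh : forall s, is_derive h s (h' s)).
{ intros s; now apply (is_derive_on_circle 1). }
assert (Dnq : forall s t, is_derive (fun t => dot (n t) (q s)) t (dot (n' t) (q s))).
{ intros s t; evar_last.
  - apply is_derive_dot; [apply Dn|apply (is_derive_const (V := R3))].
  - cbv beta; generalize (n t), (n' t), (q s); intros [[? ?] ?] [[? ?] ?] [[? ?] ?]; vec. }
assert (Dk : forall s t, is_derive (fun t => h t - dot (n t) (q s)) t (h' t - dot (n' t) (q s))).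
{ intros s t; apply (is_derive_minus (V := R_NormedModule)); [apply Dh|apply Dnq]. }
(* The curve p is differentiable at 0 only, so differentiating [eq] would not give this for other s;
   minimality with q(s) held fixed does. *)
assert (eq' : forall s, h' s = dot (n' s) (q s)).
{ intros s; apply Rminus_diag_uniq.
  apply (is_derive_minimum _ s _ (Dk s s)).
  intros t; rewrite <- eq; specialize (le s t); lra. }
assert (Dq : is_derive q 0 v).
{ evar_last.
  - apply (is_derive_minus (V := R3)); [exact Dp|apply (is_derive_const (V := R3))].
  - destruct v as [[? ?] ?]; vec. }
assert (ov : dot omega v = 0).
{ assert (D : is_derive (fun s => dot omega (p s)) 0 (dot omega v)).
  { apply is_derive_comp_R3; [apply filterdiff_linear, is_linear_dot|exact Dp]. }
  rewrite <- (is_derive_unique _ _ _ D), (Derive_ext _ (fun _ => 0)) by exact op.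
  apply Derive_const. }
assert (nv : dot (n 0) v = 0).
{ assert (D := is_derive_dot _ _ _ _ _ (Dn 0) Dq).
  apply is_derive_unique in D.
  rewrite (Derive_ext _ h) in D by (intros; now rewrite eq).
  rewrite (is_derive_unique _ _ _ (Dh 0)), eq' in D; lra. }
assert (n'v : h2 = - h 0 + dot (n' 0) v).
{ assert (D := is_derive_dot _ _ _ _ _ Dn' Dq).
  apply is_derive_unique in D.
  rewrite (Derive_ext _ h') in D by (intros; now rewrite eq').
  rewrite (is_derive_unique _ _ _ Dh2) in D; rewrite D, eq.
  generalize (n 0), (n' 0), (q 0); intros [[? ?] ?] [[? ?] ?] [[? ?] ?].
  destruct v as [[? ?] ?]; vec. }
assert (pos : 0 <= dot (n' 0) v).
{ apply (is_derive2_minimum (fun t => h t - dot (n t) (q 0)) _ 0 _ (Dk 0)).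
  - replace (dot (n' 0) v) with (h2 - (dot (opp (n 0)) (q 0) + dot (n' 0) zero)).
    + apply (is_derive_minus (V := R_NormedModule)); [exact Dh2|].
      apply (is_derive_dot n' (fun _ => q 0)); [exact Dn'|apply (is_derive_const (V := R3))].
    + rewrite n'v, eq.
      generalize (n 0), (n' 0), (q 0); intros [[? ?] ?] [[? ?] ?] [[? ?] ?].
      destruct v as [[? ?] ?]; vec.
  - intros t; rewrite <- eq; specialize (le 0 t); lra. }
rewrite (length3_orthogonal omega (n 0) v) by auto.
fold (n' 0); rewrite Rabs_pos_eq by assumption.
rewrite n'v; unfold h, n; rewrite circle_point_0; ring.
Qed.

(** Green's formula: h' K - h K' is a primitive of h'' K - h K''. It carries the operator 1 +
    d^2/dt^2 over from h to the weight K. *)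
Lemma RInt_by_parts_twice (h h1 h2 K K1 K2 : R -> R) (a b : R) :
  (forall t, is_derive h t (h1 t)) -> (forall t, is_derive h1 t (h2 t)) ->
  (forall t, continuous h2 t) ->
  (forall t, is_derive K t (K1 t)) -> (forall t, is_derive K1 t (K2 t)) ->
  (forall t, continuous K2 t) ->
  RInt (fun t => (h t + h2 t) * K t) a b =
  (h1 b * K b - h b * K1 b) - (h1 a * K a - h a * K1 a) + RInt (fun t => h t * (K t + K2 t)) a b.
Proof.
intros D1 D2 C2 E1 E2 CE.
assert (Ch : forall t, continuous h t).
{ intros t; apply (ex_derive_continuous h); eexists; apply D1. }
assert (CK : forall t, continuous K t).
{ intros t; apply (ex_derive_continuous K); eexists; apply E1. }
set (g := fun t => h1 t * K t - h t * K1 t).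
assert (Dg : forall t, is_derive g t (h2 t * K t - h t * K2 t)).
{ intros t; evar_last.
  - apply (is_derive_minus (V := R_NormedModule)); apply is_derive_Rmult; auto.
  - unfold minus, plus, opp; simpl; ring. }
assert (Cg : forall t, continuous (fun t => h2 t * K t - h t * K2 t) t).
{ intros t; apply continuous_Rminus; apply continuous_Rmult; auto. }
assert (CI : forall t, continuous (fun t => h t * (K t + K2 t)) t).
{ intros t; apply continuous_Rmult; [|apply continuous_Rplus]; auto. }
assert (I := is_RInt_derive (V := R_CompleteNormedModule) g _ a b (fun t _ => Dg t) (fun t _ => Cg t)).
apply (is_RInt_unique (V := R_CompleteNormedModule)) in I.
rewrite (RInt_ext _ (fun t => plus (h2 t * K t - h t * K2 t) (h t * (K t + K2 t)))).
2:{ intros t _; unfold plus; simpl; ring. }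
rewrite (RInt_plus (V := R_CompleteNormedModule)) by (apply ex_RInt_everywhere; assumption).
rewrite I; reflexivity.
Qed.

Lemma RInt_by_parts_zero (h h1 K K1 : R -> R) (a b : R) :
  (forall t, is_derive h t (h1 t)) -> (forall t, continuous h1 t) ->
  (forall t, is_derive K t (K1 t)) -> (forall t, continuous K1 t) ->
  K a = 0 -> K b = 0 ->
  RInt (fun t => h1 t * K t) a b = - RInt (fun t => h t * K1 t) a b.
Proof.
intros D1 C1 E1 CE Ka Kb.
assert (Ch : forall t, continuous h t).
{ intros t; apply (ex_derive_continuous h); eexists; apply D1. }
assert (CK : forall t, continuous K t).
{ intros t; apply (ex_derive_continuous K); eexists; apply E1. }
assert (I := is_RInt_derive (V := R_CompleteNormedModule) (fun t => h t * K t)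
  (fun t => h1 t * K t + h t * K1 t) a b (fun t _ => is_derive_Rmult _ _ _ _ _ (D1 t) (E1 t))).
assert (J : ex_RInt (fun t => h1 t * K t) a b).
{ apply ex_RInt_everywhere; intros; apply continuous_Rmult; auto. }
assert (J' : ex_RInt (fun t => h t * K1 t) a b).
{ apply ex_RInt_everywhere; intros; apply continuous_Rmult; auto. }
specialize (I (fun t _ => continuous_Rplus _ _ _ _ (continuous_Rmult _ _ _ _ (C1 t) (CK t))
                            (continuous_Rmult _ _ _ _ (Ch t) (CE t)))).
apply (is_RInt_unique (V := R_CompleteNormedModule)) in I.
assert (I' := RInt_plus (V := R_CompleteNormedModule) _ _ _ _ J J').
assert (E : RInt (fun t => h1 t * K t) a b + RInt (fun t => h t * K1 t) a b = h b * K b - h a * K a).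
{ etransitivity; [symmetry; exact I'|exact I]. }
rewrite Ka, Kb in E; lra.
Qed.

(** * Spherical coordinates *)

(** Coordinates in the basis (b, Omega x b, Omega), which is orthonormal and direct when b lies on
    the great circle of pole Omega. *)
Definition frame (Omega b : R3) (x y z : R) : R3 :=
  plus (plus (scal x b) (scal y (cross Omega b))) (scal z Omega).

Lemma dot_frame (Omega b : R3) (x y z x' y' z' : R) :
  S2 Omega -> great_circle Omega b ->
  dot (frame Omega b x y z) (frame Omega b x' y' z') = x * x' + y * y' + z * z'.
Proof.
intros HO [Hb Ho]; unfold S2 in *.
transitivity (x * x' * dot b b + y * y' * (dot Omega Omega * dot b b - dot Omega b * dot Omega b)
  + z * z' * dot Omega Omega + (x * z' + z * x') * dot Omega b).
- destruct Omega as [[? ?] ?], b as [[? ?] ?]; unfold frame; vec.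
- rewrite HO, Hb, Ho; ring.
Qed.

Lemma cross_frame (Omega b : R3) (x y z x' y' z' : R) :
  S2 Omega -> great_circle Omega b ->
  cross (frame Omega b x y z) (frame Omega b x' y' z') =
  frame Omega b (y * z' - z * y') (z * x' - x * z') (x * y' - y * x').
Proof.
intros HO [Hb Ho]; unfold S2 in *.
transitivity (plus (frame Omega b ((y * z' - z * y') * dot Omega Omega) (z * x' - x * z') ((x * y' - y * x') * dot b b))
  (plus (scal (- (y * z' - z * y') * dot Omega b) Omega) (scal (- (x * y' - y * x') * dot Omega b) b)) : R3).
- destruct Omega as [[? ?] ?], b as [[? ?] ?]; unfold frame; vec.
- rewrite HO, Hb, Ho; destruct Omega as [[? ?] ?], b as [[? ?] ?]; unfold frame; vec.
Qed.

Lemma is_derive_frame (Omega b : R3) (x y z : R -> R) (t x' y' z' : R) :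
  is_derive x t x' -> is_derive y t y' -> is_derive z t z' ->
  is_derive (fun s => frame Omega b (x s) (y s) (z s)) t (frame Omega b x' y' z').
Proof.
intros Hx Hy Hz.
apply (is_derive_plus (V := R3) (fun s => plus (scal (x s) b) (scal (y s) (cross Omega b)))
        (fun s => scal (z s) Omega)).
- apply (is_derive_plus (V := R3) (fun s => scal (x s) b) (fun s => scal (y s) (cross Omega b))).
  + exact (is_derive_scal_l (V := R3) x t x' b Hx).
  + exact (is_derive_scal_l (V := R3) y t y' (cross Omega b) Hy).
- exact (is_derive_scal_l (V := R3) z t z' Omega Hz).
Qed.

Lemma continuous_frame (T : UniformSpace) (Omega b : R3) (x y z : T -> R) (p : T) :
  continuous x p -> continuous y p -> continuous z p ->
  continuous (fun s => frame Omega b (x s) (y s) (z s)) p.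
Proof.
intros Hx Hy Hz.
apply (continuous_plus (V := R3) (fun s => plus (scal (x s) b) (scal (y s) (cross Omega b)))
        (fun s => scal (z s) Omega)).
- apply (continuous_plus (V := R3) (fun s => scal (x s) b) (fun s => scal (y s) (cross Omega b)));
  apply (continuous_scal (V := R3)); auto using continuous_const.
- apply (continuous_scal (V := R3)); auto using continuous_const.
Qed.

(* See circle_point_sph; point_nu, point_phi and point_tau are its partial derivatives. *)
Definition point (Omega b : R3) (nu phi tau : R) : R3 :=
  frame Omega b (- cos phi * sin tau - sin phi * sin nu * cos tau)
    (cos phi * cos tau - sin phi * sin nu * sin tau) (sin phi * cos nu).

Definition point_nu (Omega b : R3) (nu phi tau : R) : R3 :=
  frame Omega b (- sin phi * cos nu * cos tau) (- sin phi * cos nu * sin tau) (- sin phi * sin nu).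

Definition point_phi (Omega b : R3) (nu phi tau : R) : R3 :=
  frame Omega b (sin phi * sin tau - cos phi * sin nu * cos tau)
    (- sin phi * cos tau - cos phi * sin nu * sin tau) (cos phi * cos nu).

Definition point_tau (Omega b : R3) (nu phi tau : R) : R3 :=
  frame Omega b (- cos phi * cos tau + sin phi * sin nu * sin tau)
    (- cos phi * sin tau - sin phi * sin nu * cos tau) 0.

Ltac frame_eq := apply f_equal3; try ring.

Lemma S2_point (Omega b : R3) (nu phi tau : R) :
  S2 Omega -> great_circle Omega b -> S2 (point Omega b nu phi tau).
Proof.
intros HO Hb; unfold S2, point; rewrite dot_frame by assumption.
transitivity (cos phi * cos phi * (sin tau * sin tau + cos tau * cos tau)
  + sin phi * sin phi * (sin nu * sin nu * (sin tau * sin tau + cos tau * cos tau) + cos nu * cos nu));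
[ring|].
rewrite !sin2_cos2_eq; ring.
Qed.

Lemma circle_point_frame (Omega b : R3) (tau : R) :
  circle_point Omega b tau = frame Omega b (cos tau) (sin tau) 0.
Proof.
unfold frame, circle_point; generalize (cross Omega b); intros [[? ?] ?].
destruct b as [[? ?] ?], Omega as [[? ?] ?]; vec.
Qed.

Lemma sph_frame (a : R3 -> R3) (Omega : R3) (nu tau : R) :
  sph a Omega nu tau = frame Omega (a Omega) (cos nu * cos tau) (cos nu * sin tau) (sin nu).
Proof.
unfold sph; rewrite circle_point_frame; unfold frame.
generalize (cross Omega (a Omega)) (a Omega); intros [[? ?] ?] [[? ?] ?].
destruct Omega as [[? ?] ?]; vec.
Qed.

Lemma east_frame (a : R3 -> R3) (Omega : R3) (tau : R) :
  east a Omega tau = frame Omega (a Omega) (- sin tau) (cos tau) 0.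
Proof.
unfold east; rewrite circle_point_frame; frame_eq.
- rewrite cos_plus, cos_PI2, sin_PI2; ring.
- rewrite sin_plus, cos_PI2, sin_PI2; ring.
Qed.

Lemma frame_comb (Omega b : R3) (k l x y z x' y' z' : R) :
  plus (scal k (frame Omega b x y z)) (scal l (frame Omega b x' y' z')) =
  frame Omega b (k * x + l * x') (k * y + l * y') (k * z + l * z').
Proof.
unfold frame; generalize (cross Omega b); intros [[? ?] ?].
destruct b as [[? ?] ?], Omega as [[? ?] ?]; vec.
Qed.

Lemma circle_point_sph (a : R3 -> R3) (Omega : R3) (nu phi tau : R) :
  S2 Omega -> great_circle Omega (a Omega) ->
  circle_point (sph a Omega nu tau) (east a Omega tau) phi = point Omega (a Omega) nu phi tau.
Proof.
intros HO Hb; unfold circle_point, point.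
rewrite sph_frame, east_frame, cross_frame, frame_comb by assumption.
frame_eq.
replace (sin phi * (cos nu * cos tau * cos tau - cos nu * sin tau * - sin tau)) with
  (sin phi * cos nu * (sin tau * sin tau + cos tau * cos tau)) by ring.
rewrite sin2_cos2_eq; ring.
Qed.

Lemma S2_sph (a : R3 -> R3) (Omega : R3) (nu tau : R) :
  S2 Omega -> great_circle Omega (a Omega) -> S2 (sph a Omega nu tau).
Proof.
intros HO Hb; unfold S2; rewrite sph_frame, dot_frame by assumption.
transitivity (cos nu * cos nu * (sin tau * sin tau + cos tau * cos tau) + sin nu * sin nu); [ring|].
rewrite !sin2_cos2_eq; ring.
Qed.

Lemma great_circle_east (a : R3 -> R3) (Omega : R3) (nu tau : R) :
  S2 Omega -> great_circle Omega (a Omega) -> great_circle (sph a Omega nu tau) (east a Omega tau).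
Proof.
intros HO Hb; split.
- unfold S2; rewrite east_frame, dot_frame by assumption.
  transitivity (sin tau * sin tau + cos tau * cos tau); [ring|rewrite sin2_cos2_eq; ring].
- rewrite east_frame, sph_frame, dot_frame by assumption; ring.
Qed.

(** The point and its unit tangent span the plane of the circle. This identifies [d_phi] with the
    derivative found in [is_derive_on_circle]. *)
Lemma cross_point_phi (a : R3 -> R3) (Omega : R3) (nu phi tau : R) :
  S2 Omega -> great_circle Omega (a Omega) ->
  cross (point Omega (a Omega) nu phi tau) (point_phi Omega (a Omega) nu phi tau) = sph a Omega nu tau.
Proof.
intros HO Hb.
unfold point, point_phi; rewrite sph_frame, cross_frame by assumption.
assert (E := sin2_cos2_eq).
apply f_equal3.
- transitivity (cos nu * cos tau * (sin phi * sin phi + cos phi * cos phi)); [ring|rewrite E; ring].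
- transitivity (cos nu * sin tau * (sin phi * sin phi + cos phi * cos phi)); [ring|rewrite E; ring].
- transitivity (sin nu * (sin phi * sin phi + cos phi * cos phi) * (sin tau * sin tau + cos tau * cos tau));
  [ring|rewrite !E; ring].
Qed.

Lemma continuous_sin_comp (T : UniformSpace) (g : T -> R) (x : T) :
  continuous g x -> continuous (fun s => sin (g s)) x.
Proof. intros H; now apply (continuous_comp g sin), continuous_sin. Qed.

Lemma continuous_cos_comp (T : UniformSpace) (g : T -> R) (x : T) :
  continuous g x -> continuous (fun s => cos (g s)) x.
Proof. intros H; now apply (continuous_comp g cos), continuous_cos. Qed.

Lemma continuous_Ropp (T : UniformSpace) (g : T -> R) (x : T) :
  continuous g x -> continuous (fun s => - g s) x.
Proof. exact (continuous_opp (V := R_NormedModule) g x). Qed.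

Lemma continuous_pow_comp (T : UniformSpace) (g : T -> R) (n : nat) (x : T) :
  continuous g x -> continuous (fun s => g s ^ n) x.
Proof.
intros H; induction n as [|n IH]; [apply continuous_const|now apply continuous_Rmult].
Qed.

Ltac cont :=
  repeat lazymatch goal with
    | |- continuous (fun s => @?F s + @?G s) _ => apply (continuous_Rplus _ F G)
    | |- continuous (fun s => @?F s - @?G s) _ => apply (continuous_Rminus _ F G)
    | |- continuous (fun s => @?F s * @?G s) _ => apply (continuous_Rmult _ F G)
    | |- continuous (fun s => - @?F s) _ => apply (continuous_Ropp _ F)
    | |- continuous (fun s => @?F s ^ ?n) _ => apply (continuous_pow_comp _ F n)
    | |- continuous (fun s => sin (@?F s)) _ => apply (continuous_sin_comp _ F)
    | |- continuous (fun s => cos (@?F s)) _ => apply (continuous_cos_comp _ F)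
    end;
  try first [ assumption | apply continuous_const | apply continuous_id
    | apply continuous_fst | apply continuous_snd ].

Lemma cos_add_2PI (t : R) : cos (t + 2 * PI) = cos t.
Proof. rewrite cos_plus, cos_2PI, sin_2PI; ring. Qed.

Lemma sin_add_2PI (t : R) : sin (t + 2 * PI) = sin t.
Proof. rewrite sin_plus, cos_2PI, sin_2PI; ring. Qed.

(** It also takes a single factor out of an integral, with the empty second summand [0 * 0]. *)
Lemma RInt_lin (g h : R -> R) (k l x y : R) :
  (forall t, continuous g t) -> (forall t, continuous h t) ->
  RInt (fun t => k * g t + l * h t) x y = k * RInt g x y + l * RInt h x y.
Proof.
intros Cg Ch.
etransitivity.
{ apply (RInt_plus (V := R_CompleteNormedModule) (fun t => k * g t) (fun t => l * h t));
  apply ex_RInt_everywhere; intros; cont; auto. }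
apply f_equal2; apply (RInt_scal (V := R_CompleteNormedModule)); now apply ex_RInt_everywhere.
Qed.

Lemma continuous2_mult_r (g : R -> R -> R) (K : R -> R) :
  continuous2 (T := R_UniformSpace) g -> (forall t, continuous K t) ->
  continuous2 (T := R_UniformSpace) (fun x t => g x t * K t).
Proof.
intros Hg HK q; apply continuous_Rmult; [apply Hg|].
apply (continuous_comp snd K); [apply continuous_snd|apply HK].
Qed.

(** * Averages over the longitude *)

Section Averages.

Variables (f : R3 -> R) (a : R3 -> R3) (Omega : R3).
Hypothesis f_smooth : Ck_S2 2 f.
Hypothesis Omega_S2 : S2 Omega.
Hypothesis a_ref : great_circle Omega (a Omega).

Let b := a Omega.

Lemma continuous_point (T : UniformSpace) (n p t : T -> R) (x : T) :
  continuous n x -> continuous p x -> continuous t x ->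
  continuous (fun s => point Omega b (n s) (p s) (t s)) x.
Proof. intros; apply continuous_frame; cont. Qed.

Definition on_sphere (nu phi tau : R) : R := f (point Omega b nu phi tau).

(** Explicit formulas through [momentum], rather than [Derive], make the joint continuity in the
    three angles visible. *)
Definition d_nu (nu phi tau : R) : R :=
  dot (momentum f (point Omega b nu phi tau)) (cross (point Omega b nu phi tau) (point_nu Omega b nu phi tau)).

Definition d_phi (nu phi tau : R) : R :=
  dot (momentum f (point Omega b nu phi tau)) (cross (point Omega b nu phi tau) (point_phi Omega b nu phi tau)).

Definition d_tau (nu phi tau : R) : R :=
  dot (momentum f (point Omega b nu phi tau)) (cross (point Omega b nu phi tau) (point_tau Omega b nu phi tau)).

Lemma continuous_on_sphere (T : UniformSpace) (n p t : T -> R) (x : T) :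
  continuous n x -> continuous p x -> continuous t x ->
  continuous (fun s => on_sphere (n s) (p s) (t s)) x.
Proof.
intros; apply (continuous_S2 2); [assumption|intros; now apply S2_point|now apply continuous_point].
Qed.

Lemma continuous_d (T : UniformSpace) (n p t : T -> R) (v : T -> R3) (x : T) :
  continuous n x -> continuous p x -> continuous t x -> continuous v x ->
  continuous (fun s => dot (momentum f (point Omega b (n s) (p s) (t s)))
                           (cross (point Omega b (n s) (p s) (t s)) (v s))) x.
Proof.
intros.
apply continuous_dot_fun.
- apply (continuous_momentum 1); [assumption|intros; now apply S2_point|now apply continuous_point].
- apply continuous_cross; [now apply continuous_point|assumption].
Qed.

Lemma continuous_d_nu (T : UniformSpace) (n p t : T -> R) (x : T) :
  continuous n x -> continuous p x -> continuous t x ->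
  continuous (fun s => d_nu (n s) (p s) (t s)) x.
Proof. intros; apply continuous_d; try assumption; apply continuous_frame; cont. Qed.

Lemma continuous_d_phi (T : UniformSpace) (n p t : T -> R) (x : T) :
  continuous n x -> continuous p x -> continuous t x ->
  continuous (fun s => d_phi (n s) (p s) (t s)) x.
Proof. intros; apply continuous_d; try assumption; apply continuous_frame; cont. Qed.

Lemma continuous_d_tau (T : UniformSpace) (n p t : T -> R) (x : T) :
  continuous n x -> continuous p x -> continuous t x ->
  continuous (fun s => d_tau (n s) (p s) (t s)) x.
Proof. intros; apply continuous_d; try assumption; apply continuous_frame; cont. Qed.

Lemma is_derive_nu (nu phi tau : R) :
  is_derive (fun s => on_sphere s phi tau) nu (d_nu nu phi tau).
Proof.
apply (is_derive_S2 1 f (fun s => point Omega b s phi tau)); [assumption|intros; now apply S2_point|].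
apply is_derive_frame; (auto_derive; [exact I|ring]).
Qed.

Lemma is_derive_phi (nu phi tau : R) :
  is_derive (fun s => on_sphere nu s tau) phi (d_phi nu phi tau).
Proof.
apply (is_derive_S2 1 f (fun s => point Omega b nu s tau)); [assumption|intros; now apply S2_point|].
apply is_derive_frame; (auto_derive; [exact I|ring]).
Qed.

Lemma is_derive_tau (nu phi tau : R) :
  is_derive (fun s => on_sphere nu phi s) tau (d_tau nu phi tau).
Proof.
apply (is_derive_S2 1 f (fun s => point Omega b nu phi s)); [assumption|intros; now apply S2_point|].
apply is_derive_frame; (auto_derive; [exact I|ring]).
Qed.

(* The rotations about Omega, i.e. the direction point_tau, do not change averages
   over tau; this gives a first-order equation for these averages. *)
Lemma d_relation (nu phi tau : R) :
  cos nu * cos phi * d_nu nu phi tau + sin nu * sin phi * d_phi nu phi tau =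
  sin phi * d_tau nu phi tau.
Proof.
unfold d_nu, d_phi, d_tau.
set (p := point Omega b nu phi tau); set (g := momentum f p).
assert (L : forall k l u v w, plus (scal k u) (scal l v) = w ->
   k * dot g (cross p u) + l * dot g (cross p v) = dot g (cross p w)).
{ intros k l u v w <-; generalize g p; intros [[? ?] ?] [[? ?] ?].
  destruct u as [[? ?] ?], v as [[? ?] ?]; vec. }
(* The vector is sin(phi) times [point_tau]. In this direction of the (nu, phi) plane the height
   sin(phi) cos(nu) over the equator is stationary, so the point moves along its parallel. *)
rewrite (L _ _ _ _ (frame Omega b (sin phi * (- cos phi * cos tau + sin phi * sin nu * sin tau))
    (sin phi * (- cos phi * sin tau - sin phi * sin nu * cos tau)) 0)).
- unfold point_tau, frame; generalize (cross Omega b) g p; intros [[? ?] ?] [[? ?] ?] [[? ?] ?].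
  generalize b; intros [[? ?] ?].
  destruct Omega as [[? ?] ?]; vec.
- unfold point_nu, point_phi; rewrite frame_comb; apply f_equal3.
  + transitivity (sin phi * (sin phi * sin nu * sin tau)
       - sin phi * cos phi * cos tau * (sin nu * sin nu + cos nu * cos nu)); [ring|].
    rewrite (sin2_cos2_eq nu); ring.
  + transitivity (- (sin phi * (sin phi * sin nu * cos tau))
       - sin phi * cos phi * sin tau * (sin nu * sin nu + cos nu * cos nu)); [ring|].
    rewrite (sin2_cos2_eq nu); ring.
  + ring.
Qed.

Definition avg (nu phi : R) : R := RInt (on_sphere nu phi) 0 (2 * PI).
Definition avg_nu (nu phi : R) : R := RInt (d_nu nu phi) 0 (2 * PI).
Definition avg_phi (nu phi : R) : R := RInt (d_phi nu phi) 0 (2 * PI).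

Lemma continuous2_avg : continuous2 (T := R_UniformSpace) avg.
Proof.
intros q.
apply (continuous_RInt_param (prod_UniformSpace R_UniformSpace R_UniformSpace)
  (fun q t => on_sphere (fst q) (snd q) t)).
intros [p t]; apply continuous_on_sphere; [| |apply continuous_snd];
  (apply continuous_comp; [apply continuous_fst|]); [apply continuous_fst|apply continuous_snd].
Qed.

Lemma continuous2_avg_nu : continuous2 (T := R_UniformSpace) avg_nu.
Proof.
intros q.
apply (continuous_RInt_param (prod_UniformSpace R_UniformSpace R_UniformSpace)
  (fun q t => d_nu (fst q) (snd q) t)).
intros [p t]; apply continuous_d_nu; [| |apply continuous_snd];
  (apply continuous_comp; [apply continuous_fst|]); [apply continuous_fst|apply continuous_snd].
Qed.

Lemma continuous2_avg_phi : continuous2 (T := R_UniformSpace) avg_phi.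
Proof.
intros q.
apply (continuous_RInt_param (prod_UniformSpace R_UniformSpace R_UniformSpace)
  (fun q t => d_phi (fst q) (snd q) t)).
intros [p t]; apply continuous_d_phi; [| |apply continuous_snd];
  (apply continuous_comp; [apply continuous_fst|]); [apply continuous_fst|apply continuous_snd].
Qed.

Lemma is_derive_avg_nu (nu phi : R) : is_derive (fun s => avg s phi) nu (avg_nu nu phi).
Proof.
apply (is_derive_RInt_under (fun s t => on_sphere s phi t) (fun s t => d_nu s phi t)).
- intros; apply is_derive_nu.
- intros; apply continuous_on_sphere; cont.
- intros [p t]; apply continuous_d_nu; cont.
Qed.

Lemma is_derive_avg_phi (nu phi : R) : is_derive (fun s => avg nu s) phi (avg_phi nu phi).
Proof.
apply (is_derive_RInt_under (fun s t => on_sphere nu s t) (fun s t => d_phi nu s t)).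
- intros; apply is_derive_phi.
- intros; apply continuous_on_sphere; cont.
- intros [p t]; apply continuous_d_phi; cont.
Qed.

Lemma avg_relation (nu phi : R) :
  cos nu * cos phi * avg_nu nu phi = - (sin nu * sin phi * avg_phi nu phi).
Proof.
assert (Z : RInt (d_tau nu phi) 0 (2 * PI) = 0).
{ apply (is_RInt_unique (V := R_CompleteNormedModule)).
  evar_last.
  - apply (is_RInt_derive (V := R_CompleteNormedModule) (on_sphere nu phi)).
    + intros; apply is_derive_tau.
    + intros; apply continuous_d_tau; cont.
  - replace (on_sphere nu phi (2 * PI)) with (on_sphere nu phi 0).
    + apply (minus_eq_zero (on_sphere nu phi 0)).
    + unfold on_sphere, point.
      now rewrite sin_2PI, cos_2PI, sin_0, cos_0. }
apply Rplus_eq_reg_r with (sin nu * sin phi * avg_phi nu phi).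
rewrite Rplus_opp_l; unfold avg_nu, avg_phi.
rewrite <- RInt_lin; [|intros; apply continuous_d_nu; cont|intros; apply continuous_d_phi; cont].
rewrite (RInt_ext _ (fun t => sin phi * d_tau nu phi t + 0 * 0)).
2:{ intros t _; rewrite d_relation; R_ring. }
rewrite RInt_lin; [rewrite Z; ring| |intros; apply continuous_const].
intros; apply continuous_d_tau; cont.
Qed.

Lemma continuous_avg (nu phi : R) : continuous (avg nu) phi.
Proof. apply (continuous2_r R_UniformSpace avg nu phi continuous2_avg). Qed.

Lemma continuous_avg_nu (nu phi : R) : continuous (avg_nu nu) phi.
Proof. apply (continuous2_r R_UniformSpace avg_nu nu phi continuous2_avg_nu). Qed.

Lemma continuous_avg_phi (nu phi : R) : continuous (avg_phi nu) phi.
Proof. apply (continuous2_r R_UniformSpace avg_phi nu phi continuous2_avg_phi). Qed.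

(* third_primitive below, 2 / cos nu times this moment, is a primitive of the third
   integrand, by moment_equation, which combines avg_relation with an integration by
   parts in phi. *)
Definition moment (nu : R) : R :=
  RInt (fun phi => avg nu phi * (sin phi * cos phi ^ 2)) 0 (2 * PI).

Definition moment_nu (nu : R) : R :=
  RInt (fun phi => avg_nu nu phi * (sin phi * cos phi ^ 2)) 0 (2 * PI).

(** The weight is K + K'' for K = sin^3. *)
Definition third_kernel (nu : R) : R :=
  RInt (fun phi => avg nu phi * (6 * sin phi * cos phi ^ 2 - 2 * sin phi ^ 3)) 0 (2 * PI).

Lemma is_derive_moment (nu : R) : is_derive moment nu (moment_nu nu).
Proof.
apply (is_derive_RInt_under (fun s t => avg s t * (sin t * cos t ^ 2))
         (fun s t => avg_nu s t * (sin t * cos t ^ 2))).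
- intros x t; apply (is_derive_ext (fun s => (sin t * cos t ^ 2) * avg s t)).
  { intros s; apply Rmult_comm. }
  rewrite (Rmult_comm (avg_nu x t)).
  apply (is_derive_scal (fun s => avg s t)), is_derive_avg_nu.
- intros x t; apply continuous_Rmult; [apply continuous_avg|cont].
- apply (continuous2_mult_r avg_nu (fun t => sin t * cos t ^ 2)); [apply continuous2_avg_nu|].
  intros t; cont.
Qed.

Lemma moment_equation (nu : R) :
  cos nu * moment_nu nu =
  sin nu * RInt (fun phi => avg nu phi * (2 * sin phi * cos phi ^ 2 - sin phi ^ 3)) 0 (2 * PI).
Proof.
assert (C1 : forall t, continuous (fun phi => avg_phi nu phi * (sin phi ^ 2 * cos phi)) t).
{ intros t; apply continuous_Rmult; [apply continuous_avg_phi|cont]. }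
assert (C2 : forall t, continuous (fun phi => avg_nu nu phi * (sin phi * cos phi ^ 2)) t).
{ intros t; apply continuous_Rmult; [apply continuous_avg_nu|cont]. }
unfold moment_nu.
transitivity (- sin nu * RInt (fun phi => avg_phi nu phi * (sin phi ^ 2 * cos phi)) 0 (2 * PI)).
- apply Rplus_eq_reg_r with
    (sin nu * RInt (fun phi => avg_phi nu phi * (sin phi ^ 2 * cos phi)) 0 (2 * PI)).
  rewrite <- RInt_lin by assumption.
  rewrite (RInt_ext _ (fun _ => 0)), RInt_const.
  + transitivity 0; [apply Rmult_0_r|ring].
  + intros t _.
    (* One factor cos(t) of the weight sin(t) cos(t)^2 is the one in [avg_relation], which turns the
       derivative in nu into one in phi, with the weight sin(t)^2 cos(t). *)
    transitivity (sin t * cos t * (cos nu * cos t * avg_nu nu t + sin nu * sin t * avg_phi nu t));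
    [R_ring|rewrite avg_relation; R_ring].
- rewrite (RInt_by_parts_zero (avg nu) (avg_phi nu) _ (fun phi => 2 * sin phi * cos phi ^ 2 - sin phi ^ 3)).
  + ring.
  + apply is_derive_avg_phi.
  + apply continuous_avg_phi.
  + intros t; auto_derive; [exact I|ring].
  + intros t; cont.
  + rewrite sin_0; ring.
  + rewrite sin_2PI; ring.
Qed.

Definition third_primitive (nu : R) : R := 2 / cos nu * moment nu.

Lemma is_derive_third_primitive (nu : R) :
  cos nu <> 0 -> is_derive third_primitive nu (sin nu / cos nu ^ 2 * third_kernel nu).
Proof.
intros Hc.
evar_last.
{ apply (is_derive_Rmult (fun s => 2 / cos s) moment nu (2 * sin nu / cos nu ^ 2)).
  - auto_derive; [exact Hc|field; exact Hc].
  - apply is_derive_moment. }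
cbv beta.
assert (E : moment_nu nu = sin nu / cos nu *
  RInt (fun phi => avg nu phi * (2 * sin phi * cos phi ^ 2 - sin phi ^ 3)) 0 (2 * PI)).
{ apply Rmult_eq_reg_l with (cos nu); [|assumption].
  rewrite moment_equation; field; assumption. }
rewrite E.
(* The two parts come from differentiating 2 / cos and the moment. Their weights add up: 2 sin cos^2
   + 2 (2 sin cos^2 - sin^3) = 6 sin cos^2 - 2 sin^3. *)
transitivity (sin nu / cos nu ^ 2 * (2 * moment nu +
  2 * RInt (fun phi => avg nu phi * (2 * sin phi * cos phi ^ 2 - sin phi ^ 3)) 0 (2 * PI))).
- field; assumption.
- f_equal; unfold moment; rewrite <- RInt_lin.
  + apply RInt_ext; intros t _; R_ring.
  + intros t; apply continuous_Rmult; [apply continuous_avg|cont].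
  + intros t; apply continuous_Rmult; [apply continuous_avg|cont].
Qed.

Lemma continuous_third_kernel (nu : R) : continuous third_kernel nu.
Proof.
apply (continuous_RInt_param R_UniformSpace
  (fun nu phi => avg nu phi * (6 * sin phi * cos phi ^ 2 - 2 * sin phi ^ 3))).
apply continuous2_mult_r; [apply continuous2_avg|].
intros t; cont.
Qed.

(** * The singular end nu = pi/2 and the value of the improper integral *)

Definition equator_slope (tau : R) : R :=
  dot (momentum f (frame Omega b (cos tau) (sin tau) 0))
      (cross (frame Omega b (cos tau) (sin tau) 0) (frame Omega b 0 0 1)).

Lemma Derive_sph_equator (tau : R) :
  Derive (fun nu => f (sph a Omega nu tau)) 0 = equator_slope tau.
Proof.
apply is_derive_unique.
assert (D := is_derive_S2 1 f (fun nu => sph a Omega nu tau) 0 (frame Omega b 0 0 1) f_smooth).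
cbv beta in D.
replace (sph a Omega 0 tau) with (frame Omega b (cos tau) (sin tau) 0) in D.
- apply D; [intros; now apply S2_sph|].
  apply (is_derive_ext (V := R3) (fun nu => frame Omega b (cos nu * cos tau) (cos nu * sin tau) (sin nu))).
  { intros; now rewrite sph_frame. }
  apply is_derive_frame; (auto_derive; [exact I|rewrite ?sin_0, ?cos_0; ring]).
- rewrite sph_frame, sin_0, cos_0; apply f_equal3; ring.
Qed.

Lemma continuous_equator_slope (tau : R) : continuous equator_slope tau.
Proof.
assert (C : continuous (fun tau => frame Omega b (cos tau) (sin tau) 0) tau).
{ apply continuous_frame; [apply continuous_cos|apply continuous_sin|apply continuous_const]. }
apply continuous_dot_fun.
- apply (continuous_momentum 1); [assumption| |assumption].
  intros s; rewrite <- circle_point_frame; now apply S2_circle_point.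
- apply continuous_cross; [assumption|apply continuous_const].
Qed.

Lemma equator_slope_period (tau : R) : equator_slope (tau + 2 * PI) = equator_slope tau.
Proof. unfold equator_slope; now rewrite cos_add_2PI, sin_add_2PI. Qed.

Lemma RInt_equator_slope (c : R) :
  RInt (fun tau => Derive (fun nu => f (sph a Omega nu tau)) 0) 0 (2 * PI) = 0 ->
  RInt (fun tau => equator_slope (tau + c)) 0 (2 * PI) = 0.
Proof.
intros H.
rewrite RInt_period; [|apply continuous_equator_slope|apply equator_slope_period].
rewrite <- (RInt_ext _ _ _ _ (fun tau _ => Derive_sph_equator tau)); exact H.
Qed.

(** At nu = pi/2 the pole of the circle is Omega whatever tau; the circle is the equator, and tau
    only shifts its origin. *)
Lemma on_sphere_equator (phi tau : R) :
  on_sphere (PI / 2) phi tau = f (circle_point Omega b (tau + (phi + PI / 2))).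
Proof.
unfold on_sphere, point; f_equal; rewrite circle_point_frame; apply f_equal3.
- rewrite <- Rplus_assoc, cos_plus, cos_PI2, sin_PI2, sin_plus; ring.
- rewrite <- Rplus_assoc, sin_plus, cos_PI2, sin_PI2, cos_plus; ring.
- rewrite cos_PI2; ring.
Qed.

(** Changing nu tilts the equator about the East-West axis, with vertical velocity - sin(phi)
    Omega. *)
Lemma d_nu_equator (phi tau : R) :
  d_nu (PI / 2) phi tau = - sin phi * equator_slope (tau + (phi + PI / 2)).
Proof.
unfold d_nu, equator_slope.
replace (point Omega b (PI / 2) phi tau) with
  (frame Omega b (cos (tau + (phi + PI / 2))) (sin (tau + (phi + PI / 2))) 0).
- replace (point_nu Omega b (PI / 2) phi tau) with (scal (- sin phi) (frame Omega b 0 0 1)).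
  + generalize (frame Omega b 0 0 1); intros [[? ?] ?].
    generalize (frame Omega b (cos (tau + (phi + PI / 2))) (sin (tau + (phi + PI / 2))) 0).
    intros p; generalize (momentum f p) p; intros [[? ?] ?] [[? ?] ?]; vec.
  + transitivity (frame Omega b 0 0 (- sin phi)).
    * unfold frame; generalize (cross Omega b) b; intros [[? ?] ?] [[? ?] ?].
      destruct Omega as [[? ?] ?]; vec.
    * unfold point_nu; rewrite cos_PI2, sin_PI2; apply f_equal3; ring.
- unfold point; apply f_equal3.
  + rewrite <- Rplus_assoc, cos_plus, cos_PI2, sin_PI2, sin_plus; ring.
  + rewrite <- Rplus_assoc, sin_plus, cos_PI2, sin_PI2, cos_plus; ring.
  + rewrite cos_PI2; ring.
Qed.

Lemma moment_equator : moment (PI / 2) = 0.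
Proof.
assert (Cf : forall t, continuous (fun t => f (circle_point Omega b t)) t).
{ intros t; apply (ex_derive_continuous (fun t => f (circle_point Omega b t))).
  eexists; now apply (is_derive_on_circle 1). }
set (m := RInt (fun t => f (circle_point Omega b t)) 0 (2 * PI)).
assert (A : forall phi, avg (PI / 2) phi = m).
{ intros phi; unfold avg.
  rewrite (RInt_ext _ (fun tau => f (circle_point Omega b (tau + (phi + PI / 2))))).
  - apply (RInt_period (fun t => f (circle_point Omega b t))); [assumption|].
    intros t; unfold circle_point; now rewrite cos_add_2PI, sin_add_2PI.
  - intros; apply on_sphere_equator. }
unfold moment.
apply (is_RInt_unique (V := R_CompleteNormedModule)).
apply (is_RInt_ext (V := R_NormedModule) (fun phi => m * (sin phi * cos phi ^ 2))).
{ intros phi _; now rewrite A. }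
evar_last.
- apply (is_RInt_derive (V := R_CompleteNormedModule) (fun phi => - m * cos phi ^ 3 / 3)).
  + intros t _; auto_derive; [exact I|field].
  + intros t _; cont.
- rewrite cos_0, cos_2PI; unfold minus, plus, opp; simpl; ring.
Qed.

(** The average of [d_nu] over tau is - sin(phi) times the mean slope along the equator, which is
    what the centroid condition annihilates. A nonzero mean slope would give [third_primitive] a
    nonzero limit. *)
Lemma moment_nu_equator :
  RInt (fun tau => Derive (fun nu => f (sph a Omega nu tau)) 0) 0 (2 * PI) = 0 ->
  moment_nu (PI / 2) = 0.
Proof.
intros H; unfold moment_nu.
rewrite (RInt_ext _ (fun _ => 0)).
- rewrite RInt_const; apply Rmult_0_r.
- intros phi _; apply Rmult_eq_0_compat_r; unfold avg_nu.
  rewrite (RInt_ext _ (fun tau => - sin phi * equator_slope (tau + (phi + PI / 2)) + 0 * 0)).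
  + rewrite RInt_lin; [rewrite RInt_equator_slope by assumption; ring| |intros; cont].
    intros t; apply (continuous_comp (fun t => t + (phi + PI / 2)) equator_slope).
    * apply (continuous_Rplus _ (fun t => t)); [apply continuous_id|apply continuous_const].
    * apply continuous_equator_slope.
  + intros tau _; rewrite d_nu_equator; R_ring.
Qed.

(** With h = x - pi/2, the moment is o(h) since it vanishes at pi/2 together with its derivative,
    whereas cos x is of exact order |h|. *)
Lemma third_primitive_limit :
  RInt (fun tau => Derive (fun nu => f (sph a Omega nu tau)) 0) 0 (2 * PI) = 0 ->
  filterlim third_primitive (at_left (PI / 2)) (locally 0).
Proof.
intros H.
apply (filterlim_locally third_primitive); intros eps.
assert (He := cond_pos eps).
assert (D := is_derive_moment (PI / 2)).
rewrite moment_nu_equator in D by assumption.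
apply is_derive_Reals in D.
(* The tolerance 1/2 for the slope -1 of cos gives cos x > |h|/2, and then 2 (eps/8) |h| = eps |h|/4
   is below eps cos x. *)
destruct (D (eps / 8)) as [d1 H1]; [lra|].
assert (D' := derivable_pt_lim_cos (PI / 2)).
destruct (D' (1 / 2)) as [d2 H2]; [lra|].
assert (Hd : 0 < Rmin d1 d2) by (apply Rmin_glb_lt; apply cond_pos).
exists (mkposreal _ Hd); intros x; change R in x; intros Bx Hx.
set (h := x - PI / 2).
assert (Hh : h < 0) by (unfold h; lra).
change (Rabs h < Rmin d1 d2) in Bx.
assert (B1 := Rlt_le_trans _ _ _ Bx (Rmin_l d1 d2)).
assert (B2 := Rlt_le_trans _ _ _ Bx (Rmin_r d1 d2)).
specialize (H1 h ltac:(lra) B1); specialize (H2 h ltac:(lra) B2).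
replace (PI / 2 + h) with x in * by (unfold h; ring).
rewrite moment_equator in H1.
rewrite cos_PI2, sin_PI2 in H2.
assert (E2 : cos x = (cos x - 0) / h * h) by (field; lra).
assert (E1 : moment x = ((moment x - 0) / h - 0) * h) by (field; lra).
apply Rabs_def2 in H2.
assert (P : - h / 2 < cos x).
{ rewrite E2; set (k := (cos x - 0) / h) in *; nra. }
change (Rabs (third_primitive x - 0) < eps).
rewrite Rminus_0_r; unfold third_primitive.
rewrite Rabs_mult, Rabs_div, (Rabs_pos_eq 2), (Rabs_pos_eq (cos x)) by lra.
rewrite E1, Rabs_mult, (Rabs_left h) by assumption.
set (k := Rabs ((moment x - 0) / h - 0)) in *.
assert (0 <= k) by apply Rabs_pos.
apply Rmult_lt_reg_r with (cos x); [lra|].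
replace (2 / cos x * (k * - h) * cos x) with (2 * k * - h) by (field; lra).
nra.
Qed.

Lemma is_RInt_gen_third_kernel :
  RInt (fun tau => Derive (fun nu => f (sph a Omega nu tau)) 0) 0 (2 * PI) = 0 ->
  is_RInt_gen (fun nu => sin nu / cos nu ^ 2 * third_kernel nu) (at_point 0) (at_left (PI / 2))
    (- (2 * moment 0)).
Proof.
intros H.
assert (HPI := PI_RGT_0).
(* The lower end 0 has to be interior to the interval where the primitive is differentiated, hence -
   pi/2 in place of 0. *)
assert (F : filter_prod (at_point 0) (at_left (PI / 2)) (fun ab : R * R =>
  forall x, Rmin (fst ab) (snd ab) <= x <= Rmax (fst ab) (snd ab) -> - (PI / 2) < x < PI / 2)).
{ apply (Filter_prod _ _ _ (fun x => x = 0) (fun x => 0 < x < PI / 2)).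
  - reflexivity.
  - assert (P2 : 0 < PI / 2) by lra.
    exists (mkposreal _ P2); intros x; change R in x; intros Bx Hx.
    change (Rabs (x - PI / 2) < PI / 2) in Bx; apply Rabs_def2 in Bx; lra.
  - simpl; intros x y -> Hy z; rewrite Rmin_left, Rmax_right; lra. }
assert (D : forall x, - (PI / 2) < x < PI / 2 ->
  is_derive third_primitive x (sin x / cos x ^ 2 * third_kernel x)).
{ intros x Hx; apply is_derive_third_primitive, Rgt_not_eq, cos_gt_0; lra. }
replace (- (2 * moment 0)) with (0 - third_primitive 0).
2:{ unfold third_primitive; rewrite cos_0; field. }
apply (is_RInt_gen_ext (V := R_NormedModule) (Derive third_primitive)).
{ revert F; apply filter_imp; intros [x y] F z Hz.
  apply is_derive_unique, D, F; lra. }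
apply is_RInt_gen_Derive.
- revert F; apply filter_imp; intros [x y] F z Hz; eexists; now apply D, F.
- revert F; apply filter_imp; intros [x y] F z Hz; specialize (F z Hz).
  apply (continuous_ext_loc _ (fun nu => sin nu / cos nu ^ 2 * third_kernel nu)).
  + apply (locally_interval _ z (- (PI / 2)) (PI / 2)); simpl; try lra.
    intros t t1 t2; symmetry; apply is_derive_unique, D; lra.
  + apply continuous_Rmult; [|apply continuous_third_kernel].
    apply (ex_derive_continuous (fun nu => sin nu / cos nu ^ 2)).
    auto_derive; repeat split.
    rewrite Rmult_1_r; apply Rmult_integral_contrapositive_currified;
      apply Rgt_not_eq, cos_gt_0; lra.
- intros P HP; exact (locally_singleton _ _ HP).
- now apply third_primitive_limit.
Qed.

(* phi -> PI - phi is the rotation tau -> tau + PI when nu = 0. *)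
Lemma moment_half :
  moment 0 = 2 * RInt (fun phi => avg 0 phi * (sin phi * cos phi ^ 2)) (- (PI / 2)) (PI / 2).
Proof.
set (g := fun phi => avg 0 phi * (sin phi * cos phi ^ 2)).
assert (Cg : forall t, continuous g t).
{ intros t; apply continuous_Rmult; [apply continuous_avg|cont]. }
assert (Pg : forall t, g (t + 2 * PI) = g t).
{ intros t; unfold g, avg; rewrite sin_add_2PI, cos_add_2PI.
  f_equal; apply RInt_ext; intros tau _.
  unfold on_sphere, point; now rewrite sin_add_2PI, cos_add_2PI. }
assert (Sg : forall t, g (PI - t) = g t).
{ intros t; unfold g.
  replace (sin (PI - t)) with (sin t) by (symmetry; apply sin_PI_x).
  replace (cos (PI - t) ^ 2) with (cos t ^ 2).
  2:{ rewrite cos_minus, cos_PI, sin_PI; ring. }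
  f_equal; unfold avg.
  rewrite <- (RInt_period (on_sphere 0 t) (2 * PI) PI).
  - apply RInt_ext; intros tau _; unfold on_sphere, point; f_equal.
    rewrite cos_minus, sin_minus, cos_plus, sin_plus, cos_PI, sin_PI, sin_0, cos_0.
    apply f_equal3; ring.
  - intros; apply continuous_on_sphere; cont.
  - intros tau; unfold on_sphere, point; now rewrite sin_add_2PI, cos_add_2PI. }
unfold moment; fold g.
assert (X : forall x y, ex_RInt g x y) by (intros; now apply ex_RInt_everywhere).
(* The full turn is taken as [- pi/2, 3 pi/2], whose two halves are exchanged by t -> pi - t. *)
rewrite <- (RInt_period g (2 * PI) (- (PI / 2))) by assumption.
rewrite RInt_shift by assumption.
rewrite <- (RInt_Chasles g _ (PI / 2)) by apply X.
assert (E := RInt_comp_lin (V := R_CompleteNormedModule) g (-1) PI (- (PI / 2)) (PI / 2) (X _ _)).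
rewrite (RInt_ext _ (fun t => (-1) * g t + 0 * g t)) in E.
2:{ intros t _; rewrite <- (Sg t); unfold scal; simpl; unfold mult; simpl.
    replace (-1 * t + PI) with (PI - t) by ring; R_ring. }
rewrite RInt_lin in E by assumption.
replace (-1 * - (PI / 2) + PI) with (2 * PI + - (PI / 2)) in E by field.
replace (-1 * (PI / 2) + PI) with (PI / 2) in E by field.
assert (E' : - RInt g (PI / 2) (2 * PI + - (PI / 2)) = RInt g (2 * PI + - (PI / 2)) (PI / 2))
  by exact (opp_RInt_swap (V := R_CompleteNormedModule) g _ _ (X _ _)).
rewrite Rplus_0_l.
change (RInt g (- (PI / 2)) (PI / 2) + RInt g (PI / 2) (2 * PI + - (PI / 2))
        = 2 * RInt g (- (PI / 2)) (PI / 2)).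
lra.
Qed.

(** * The three terms of the representation *)

Variable Rad : R3 -> R3 -> R.
Hypothesis Rad_eq : forall omega u, S2 omega -> great_circle omega u ->
  exists h2 : R -> R,
    (forall t, is_derive (fun s => dot (momentum f (circle_point omega u s)) omega) t (h2 t)) /\
    (forall t, continuous h2 t) /\
    (forall t, Rad omega (circle_point omega u t) = f (circle_point omega u t) + h2 t).
Hypothesis centroid :
  RInt (fun tau => Derive (fun nu => f (sph a Omega nu tau)) 0) 0 (2 * PI) = 0.

(** With nu and tau fixed, continuity of the second derivative along one circle is enough. What
    remains contains only f and its first derivative, which are jointly continuous and can be
    integrated further. *)
Lemma RInt_radius (nu tau x y : R) (K K1 K2 : R -> R) :
  (forall t, is_derive K t (K1 t)) -> (forall t, is_derive K1 t (K2 t)) ->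
  (forall t, continuous K2 t) ->
  RInt (fun phi => radius_at Rad a Omega nu tau phi * K phi) x y =
  (d_phi nu y tau * K y - on_sphere nu y tau * K1 y)
  - (d_phi nu x tau * K x - on_sphere nu x tau * K1 x)
  + RInt (fun phi => on_sphere nu phi tau * (K phi + K2 phi)) x y.
Proof.
intros D1 D2 C2.
destruct (Rad_eq (sph a Omega nu tau) (east a Omega tau)) as [h2 [H2 [Ch2 HR]]].
{ now apply S2_sph. }
{ now apply great_circle_east. }
rewrite <- (RInt_by_parts_twice (fun phi => on_sphere nu phi tau) (fun phi => d_phi nu phi tau) h2); auto.
- apply RInt_ext; intros t _; unfold radius_at; cbv zeta.
  now rewrite HR, circle_point_sph by assumption.
- intros t; apply is_derive_phi.
- intros t; apply (is_derive_ext (fun s =>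
    dot (momentum f (circle_point (sph a Omega nu tau) (east a Omega tau) s)) (sph a Omega nu tau))).
  + intros s; unfold d_phi, b.
    now rewrite cross_point_phi, circle_point_sph by assumption.
  + apply H2.
Qed.

(** sin^3 and 3 sin^2 cos vanish at both ends, so no boundary term remains; exchanging the integrals
    then makes the average over tau appear. *)
Lemma third_integrand_third_kernel (nu : R) :
  third_integrand Rad a Omega nu = sin nu / cos nu ^ 2 * third_kernel nu.
Proof.
unfold third_integrand, third_kernel, avg; f_equal.
set (w := fun phi => 6 * sin phi * cos phi ^ 2 - 2 * sin phi ^ 3).
assert (Cw : forall t, continuous w t) by (intros t; unfold w; cont).
transitivity (RInt (fun tau => RInt (fun phi => on_sphere nu phi tau * w phi) 0 (2 * PI)) 0 (2 * PI)).
- apply RInt_ext; intros tau _.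
  rewrite (RInt_radius nu tau 0 (2 * PI) (fun t => sin t ^ 3) (fun t => 3 * sin t ^ 2 * cos t)
             (fun t => 6 * sin t * cos t ^ 2 - 3 * sin t ^ 3)).
  + rewrite sin_2PI, sin_0.
    rewrite (RInt_ext _ (fun phi => on_sphere nu phi tau * w phi)); [R_ring|].
    intros t _; unfold w; R_ring.
  + intros t; auto_derive; [exact I|ring].
  + intros t; auto_derive; [exact I|ring].
  + intros t; cont.
- rewrite (RInt_swap_order (fun tau phi => on_sphere nu phi tau * w phi)).
  + apply RInt_ext; intros phi _.
    rewrite (RInt_ext _ (fun tau => w phi * on_sphere nu phi tau + 0 * 0)).
    2:{ intros; R_ring. }
    rewrite RInt_lin; [| |intros; apply continuous_const].
    { change (w phi * avg nu phi + 0 * RInt (fun _ => 0) 0 (2 * PI) = avg nu phi * w phi); ring. }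
    intros; apply continuous_on_sphere; cont.
  + intros q; apply continuous_Rmult; [apply continuous_on_sphere; cont|].
    apply (continuous_comp snd w); [apply continuous_snd|apply Cw].
  + generalize PI_RGT_0; lra.
Qed.

(** For nu = 0 the circles are meridians with latitude phi, all passing through Omega. *)
Lemma on_sphere_pole (tau : R) : on_sphere 0 (PI / 2) tau = f Omega.
Proof.
unfold on_sphere, point; f_equal; rewrite cos_PI2, sin_PI2, sin_0, cos_0.
unfold frame; generalize (cross Omega b) b; intros [[? ?] ?] [[? ?] ?].
destruct Omega as [[? ?] ?]; vec.
Qed.

Lemma d_phi_equator (tau : R) : d_phi 0 0 tau = equator_slope (tau + PI / 2).
Proof.
unfold d_phi, equator_slope.
replace (point Omega b 0 0 tau) with (frame Omega b (cos (tau + PI / 2)) (sin (tau + PI / 2)) 0).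
- replace (point_phi Omega b 0 0 tau) with (frame Omega b 0 0 1); [reflexivity|].
  unfold point_phi; rewrite cos_0, sin_0; apply f_equal3; ring.
- unfold point; rewrite cos_plus, sin_plus, cos_PI2, sin_PI2, cos_0, sin_0; apply f_equal3; ring.
Qed.

(** The weight cos satisfies K + K'' = 0, so only H(Omega) and a slope at the equator are left, and
    the slopes have mean 0 by the centroid condition. *)
Lemma first_term :
  RInt (fun tau => RInt (fun phi => radius_at Rad a Omega 0 tau phi * cos phi) 0 (PI / 2)) 0 (2 * PI)
  = 2 * PI * f Omega.
Proof.
rewrite (RInt_ext _ (fun tau => 1 * f Omega + -1 * equator_slope (tau + PI / 2))).
- rewrite RInt_lin.
  + rewrite RInt_equator_slope by assumption.
    rewrite RInt_const; unfold scal; simpl; unfold mult; simpl; ring.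
  + intros; apply continuous_const.
  + intros t; apply (continuous_comp (fun t => t + PI / 2) equator_slope).
    * apply (continuous_Rplus _ (fun t => t)); [apply continuous_id|apply continuous_const].
    * apply continuous_equator_slope.
- intros tau _.
  rewrite (RInt_radius 0 tau 0 (PI / 2) cos (fun t => - sin t) (fun t => - cos t)).
  + rewrite (RInt_ext _ (fun _ => 0)), RInt_const by (intros; R_ring).
    rewrite on_sphere_pole, d_phi_equator, cos_PI2, sin_PI2, cos_0, sin_0.
    unfold scal; simpl; unfold mult; simpl; ring.
  + intros t; auto_derive; [exact I|ring].
  + intros t; auto_derive; [exact I|ring].
  + intros t; apply (continuous_Ropp _ cos), continuous_cos.
Qed.

(** Here p is meant to be Omega or its antipode, where all meridians meet: tau then enters only
    through the axis of the meridian, the equator point of longitude tau. *)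
Lemma d_phi_pole (e tau : R) (p : R3) :
  point Omega b 0 e tau = p ->
  d_phi 0 e tau = cos tau * dot (momentum f p) b + sin tau * dot (momentum f p) (cross Omega b).
Proof.
intros Hp; unfold d_phi, b; rewrite cross_point_phi by assumption; fold b; rewrite Hp.
rewrite sph_frame, cos_0, sin_0; fold b; unfold frame.
generalize (cross Omega b) b (momentum f p); intros [[? ?] ?] [[? ?] ?] [[? ?] ?].
destruct Omega as [[? ?] ?]; vec.
Qed.

(* The boundary terms at the poles are d_phi at +-Omega, i.e. cos tau, sin tau times
   constants, hence of mean 0; the weight K satisfies K + K'' = -16 sin cos^2. *)
Lemma second_term :
  RInt (fun tau => RInt (fun phi => radius_at Rad a Omega 0 tau phi *
                       ((PI + 2 * phi) * cos phi - 2 * sin phi ^ 3)) (- (PI / 2)) (PI / 2)) 0 (2 * PI)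
  = 4 * PI ^ 2 * f Omega - 8 * moment 0.
Proof.
set (w := fun phi => sin phi * cos phi ^ 2).
assert (Cw : forall t, continuous w t) by (intros t; unfold w; cont).
assert (CI : continuous2 (T := R_UniformSpace) (fun tau phi => on_sphere 0 phi tau * w phi)).
{ intros q; apply continuous_Rmult; [apply continuous_on_sphere; cont|].
  apply (continuous_comp snd w); [apply continuous_snd|apply Cw]. }
assert (pole : exists q, forall tau, point Omega b 0 (PI / 2) tau = q).
{ exists (frame Omega b 0 0 1); intros tau; unfold point.
  rewrite cos_PI2, sin_PI2, sin_0, cos_0; apply f_equal3; ring. }
assert (pole' : exists q, forall tau, point Omega b 0 (- (PI / 2)) tau = q).
{ exists (frame Omega b 0 0 (-1)); intros tau; unfold point.
  rewrite cos_neg, sin_neg, cos_PI2, sin_PI2, sin_0, cos_0; apply f_equal3; ring. }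
destruct pole as [p Hp], pole' as [p' Hp'].
set (A := - 2 * (dot (momentum f p) b + dot (momentum f p') b)).
set (A' := - 2 * (dot (momentum f p) (cross Omega b) + dot (momentum f p') (cross Omega b))).
set (J := fun tau => RInt (fun phi => on_sphere 0 phi tau * w phi) (- (PI / 2)) (PI / 2)).
assert (CJ : forall t, continuous J t).
{ intros t; exact (continuous_RInt_param R_UniformSpace
    (fun tau phi => on_sphere 0 phi tau * w phi) _ _ t CI). }
(* The weight is -2 at pi/2 and 2 at - pi/2, which gives A and A'. Its derivative is - 2 pi at pi/2,
   whence 2 pi f(Omega), and 0 at - pi/2. *)
rewrite (RInt_ext _ (fun tau => 1 * (A * cos tau + A' * sin tau) + 1 * (2 * PI * f Omega + -16 * J tau))).
- rewrite RInt_lin; [|intros; cont|].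
  + assert (Z : RInt (fun tau => A * cos tau + A' * sin tau) 0 (2 * PI) = 0).
    { apply (is_RInt_unique (V := R_CompleteNormedModule)).
      evar_last.
      - apply (is_RInt_derive (V := R_CompleteNormedModule) (fun t => A * sin t - A' * cos t)).
        + intros t _; auto_derive; [exact I|ring].
        + intros t _; cont.
      - rewrite sin_0, cos_0, sin_2PI, cos_2PI; unfold minus, plus, opp; simpl; ring. }
    rewrite Z, RInt_lin; [|intros; apply continuous_const|assumption].
    (* J covers only half a turn in phi, hence half of the moment; the factor -16 becomes -8. *)
    assert (EJ : RInt J 0 (2 * PI) = moment 0 / 2).
    { unfold J; rewrite (RInt_swap_order (fun tau phi => on_sphere 0 phi tau * w phi));
        [|assumption|generalize PI_RGT_0; lra].
      rewrite moment_half.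
      assert (half : forall x, x = 2 * x / 2) by (intros; field).
      rewrite <- half.
      apply RInt_ext; intros phi _; unfold avg.
      rewrite (RInt_ext _ (fun tau => w phi * on_sphere 0 phi tau + 0 * 0)).
      2:{ intros; R_ring. }
      rewrite RInt_lin; [| |intros; apply continuous_const].
      { change (w phi * avg 0 phi + 0 * RInt (fun _ => 0) 0 (2 * PI) = avg 0 phi * w phi); ring. }
      intros; apply continuous_on_sphere; cont. }
    rewrite EJ, RInt_const; unfold scal; simpl; unfold mult; simpl.
    match goal with |- @eq _ ?x ?y => change (@eq R x y) end; field.
  + intros t; apply (continuous_Rplus _ (fun _ => 2 * PI * f Omega) (fun t => -16 * J t)).
    * apply continuous_const.
    * apply (continuous_Rmult _ (fun _ => -16) J); [apply continuous_const|apply CJ].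
- intros tau _.
  rewrite (RInt_radius 0 tau (- (PI / 2)) (PI / 2) (fun t => (PI + 2 * t) * cos t - 2 * sin t ^ 3)
    (fun t => 2 * cos t - (PI + 2 * t) * sin t - 6 * sin t ^ 2 * cos t)
    (fun t => - 4 * sin t - (PI + 2 * t) * cos t - 12 * sin t * cos t ^ 2 + 6 * sin t ^ 3)).
  + rewrite (d_phi_pole _ _ p) by apply Hp.
    rewrite (d_phi_pole _ _ p') by apply Hp'.
    rewrite on_sphere_pole, cos_neg, sin_neg, cos_PI2, sin_PI2.
    rewrite (RInt_ext _ (fun phi => -16 * (on_sphere 0 phi tau * w phi) + 0 * 0)).
    2:{ intros t _; unfold w; simpl.
        assert (E := sin2_cos2_eq t).
        replace (sin t * (sin t * (sin t * 1))) with (sin t * (sin t * sin t)) by ring.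
        rewrite E; R_ring. }
    rewrite RInt_lin; [| |intros; apply continuous_const].
    * fold (J tau); unfold A, A'; simpl; field.
    * intros t; exact (continuous2_r R_UniformSpace (fun tau phi => on_sphere 0 phi tau * w phi) tau t CI).
  + intros t; auto_derive; [exact I|ring].
  + intros t; auto_derive; [exact I|ring].
  + intros t.
    apply (ex_derive_continuous (fun t => - 4 * sin t - (PI + 2 * t) * cos t - 12 * sin t * cos t ^ 2 + 6 * sin t ^ 3)).
    auto_derive; exact I.
Qed.

Lemma is_RInt_gen_third_integrand :
  is_RInt_gen (third_integrand Rad a Omega) (at_point 0) (at_left (PI / 2)) (- (2 * moment 0)).
Proof.
apply (is_RInt_gen_ext (V := R_NormedModule) (fun nu => sin nu / cos nu ^ 2 * third_kernel nu)).
- apply filter_forall; intros [x y] z _; symmetry; apply third_integrand_third_kernel.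
- now apply is_RInt_gen_third_kernel.
Qed.

Lemma representation_eq : representation Rad a Omega = f Omega.
Proof.
unfold representation; rewrite first_term, second_term.
rewrite (is_RInt_gen_unique (V := R_CompleteNormedModule) _ _ is_RInt_gen_third_integrand).
field; apply Rgt_not_eq, PI_RGT_0.
Qed.

End Averages.

(** * From the convex body to the theorem *)

Lemma circle_point_add (omega u : R3) (s t : R) :
  S2 omega -> great_circle omega u ->
  circle_point omega (circle_point omega u t) s = circle_point omega u (t + s).
Proof.
intros Hw Hu; unfold circle_point at 1; rewrite cross_circle_point by assumption.
unfold circle_point; rewrite cos_plus, sin_plus.
generalize (cross omega u); intros [[? ?] ?]; destruct u as [[? ?] ?]; vec.
Qed.

(** The radius is characterised at the angle 0 from each direction u; moving u by t along its circle
    and shifting the parameter reaches every angle. *)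
Lemma curvature_radius_on_circle (B : R3 -> Prop) (Rad : R3 -> R3 -> R) (O omega u : R3) :
  convex_body B -> Ck_S2 2 (support B O) -> is_proj_curvature_radius B Rad ->
  S2 omega -> great_circle omega u ->
  exists h2 : R -> R,
    (forall t, is_derive (fun s => dot (momentum (support B O) (circle_point omega u s)) omega) t (h2 t)) /\
    (forall t, continuous h2 t) /\
    (forall t, Rad omega (circle_point omega u t) = support B O (circle_point omega u t) + h2 t).
Proof.
intros HB Hf HRad Hw Hu.
destruct (is_derive2_on_circle 0 (support B O) omega u Hf Hw Hu) as [h2 [H2 C2]].
exists h2; split; [exact H2|split; [exact C2|intros t]].
assert (Ht := great_circle_circle_point omega u t Hw Hu).
apply (projection_curvature_radius B O omega (circle_point omega u t)); auto.
apply (is_derive_ext (fun s => dot (momentum (support B O) (circle_point omega u (t + s))) omega)).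
{ intros s; now rewrite circle_point_add. }
rewrite <- (Rmult_1_l (h2 t)).
apply (is_derive_comp (fun s => dot (momentum (support B O) (circle_point omega u s)) omega) (fun s => t + s)).
- rewrite Rplus_0_r; apply H2.
- auto_derive; [exact I|ring].
Qed.

Theorem theorem1p2 (B : R3 -> Prop) (Rad : R3 -> R3 -> R) (a : R3 -> R3) (O : R3)
  (B_body : convex_body B)
  (B_smooth : smooth_body 3 B)
  (Rad_B : is_proj_curvature_radius B Rad)
  (a_ref : reference_points a)
  (O_centroid : is_centroid a B O) :
  (forall Omega, S2 Omega ->
     ex_RInt_gen (third_integrand Rad a Omega) (at_point 0) (at_left (PI / 2)) /\
     support B O Omega = representation Rad a Omega) /\
  spherical_solution Rad (representation Rad a).
Proof.
assert (Hf : Ck_S2 2 (support B O)) by now apply Ck_S2_pred, Ck_S2_support.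
assert (HR := fun omega u => curvature_radius_on_circle B Rad O omega u B_body Hf Rad_B).
assert (E : forall Omega, S2 Omega -> representation Rad a Omega = support B O Omega).
{ intros Omega HO; apply representation_eq; auto. }
split; [|split].
- intros Omega HO; split; [|now rewrite E].
  eexists; apply (is_RInt_gen_third_integrand (support B O) a Omega); auto.
(* The representation equals the support function on the sphere only, and that is all an extension F
   has to match. *)
- intros p Sp; destruct (Hf p Sp) as [U [F [oU [Up [HF EF]]]]].
  exists U, F; split; [|split; [|split]]; try assumption.
  intros x Ux Sx; rewrite E by assumption; now apply EF.
- intros omega u Hw Hu phi H_omega; unfold H_omega.
  destruct (HR omega u Hw Hu) as [h2 [H2 [_ ->]]].
  rewrite E by now apply S2_circle_point.
  rewrite (Derive_n_ext _ (fun t => support B O (circle_point omega u t))).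
  2:{ intros t; now apply E, S2_circle_point. }
  f_equal; simpl.
  rewrite (Derive_ext _ (fun s => dot (momentum (support B O) (circle_point omega u s)) omega)).
  + now apply is_derive_unique.
  + intros t; apply is_derive_unique; now apply (is_derive_on_circle 1).
Qed.
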